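(* The affine coordinate ring $R_{\Pi}$ of $\Pi_{\mathbb{A}}^{15}$ is a UFD.
   Context: We work over $\mathbb{C}$. Let $S_{\Pi}$ be the polynomial ring over $\mathbb{C}$ in the $19$ variables $p_1,p_2,p_3,p_4,u,v,t_1,t_2$, $L_{123},L_{124},L_{125},L_{126},L_{135},L_{136},L_{245},L_{246}$, $s_1,s_2,s_3$. Abbreviate $\Delta=p_1p_4-p_2p_3$, $\lambda(X,Y,Z)=L_{136}X+L_{245}Y+L_{246}Z$, $\mu(X,Y,Z)=L_{135}X+L_{136}Y+L_{245}Z$, $U_1=p_1^2+t_1p_2^2+p_2u$, $U_2=2p_1p_3+2t_1p_2p_4+p_4u+p_2v$, $U_3=p_3^2+t_1p_4^2+p_4v$, $I_1=t_2p_2^2+p_1u$, $I_2=2t_2p_2p_4+p_3u+p_1v$, $I_3=t_2p_4^2+p_3v$, $W_1=t_1p_2u-t_2p_1p_2+u^2$, $W_2=t_1(p_4u+p_2v)-t_2(p_2p_3+p_1p_4)+2uv$, $W_3=t_1p_4v-t_2p_3p_4+v^2$, $\kappa_1=L_{135}L_{245}-L_{136}^2$, $\kappa_2=L_{135}L_{246}-L_{136}L_{245}$, $\kappa_3=L_{136}L_{246}-L_{245}^2$. Let $I_{\Pi}\subset S_{\Pi}$ be the ideal generated by \begin{align*} F_1&=us_1-p_1s_2-p_2s_3-L_{126}\Delta-\lambda(U_1,U_2,U_3),\\ F_2&=vs_1-p_3s_2-p_4s_3+L_{125}\Delta+\mu(U_1,U_2,U_3),\\ F_3&=-t_2p_2s_1+(u+t_1p_2)s_2-p_1s_3-L_{124}\Delta-\lambda(I_1,I_2,I_3),\\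 F_4&=-t_2p_4s_1+(v+t_1p_4)s_2-p_3s_3+L_{123}\Delta+\mu(I_1,I_2,I_3),\\ F_5&=-t_2p_1s_1+(t_1p_1-t_2p_2)s_2+(u+t_1p_2)s_3+L_{123}U_1+L_{124}(p_1p_3+t_1p_2p_4+p_2v)\\&\quad-L_{125}I_1-L_{126}(t_2p_2p_4+p_1v)-\lambda(W_1,W_2,W_3),\\ F_6&=-t_2p_3s_1+(t_1p_3-t_2p_4)s_2+(v+t_1p_4)s_3+L_{123}(p_1p_3+t_1p_2p_4+p_4u)+L_{124}U_3\\&\quad-L_{125}(t_2p_2p_4+p_3u)-L_{126}I_3+\mu(W_1,W_2,W_3),\\ F_7&=-s_2^2+s_1s_3+(L_{123}p_2+L_{124}p_4)s_1-(L_{125}p_2+L_{126}p_4)s_2\\&\quad+L_{123}\lambda(p_2^2,2p_2p_4,p_4^2)-L_{124}\mu(p_2^2,2p_2p_4,p_4^2)\\&\quad-L_{125}\lambda(p_1p_2,p_2p_3+p_1p_4,p_3p_4)+L_{126}\mu(p_1p_2,p_2p_3+p_1p_4,p_3p_4)\\&\quad+\kappa_1(-p_1^2+2up_2+t_1p_2^2)+\kappa_2(-p_1p_3+up_4+vp_2+t_1p_2p_4)+\kappa_3(-p_3^2+2vp_4+t_1p_4^2),\\ F_8&=s_2s_3+t_1s_1s_2-t_2s_1^2+s_1(L_{123}p_1+L_{124}p_3)-s_2(L_{125}p_1+L_{126}p_3)\\&\quad+L_{123}\lambda(p_1p_2,p_1p_4+p_2p_3,p_3p_4)-L_{124}\mu(p_1p_2,p_1p_4+p_2p_3,p_3p_4)\\&\quad-L_{125}\lambda(p_1^2,2p_1p_3,p_3^2)+L_{126}\mu(p_1^2,2p_1p_3,p_3^2)\\&\quad+\kappa_1(2up_1+2t_1p_1p_2-t_2p_2^2)+\kappa_2(vp_1+up_3+t_1(p_1p_4+p_2p_3)-t_2p_2p_4)+\kappa_3(2vp_3+2t_1p_3p_4-t_2p_4^2),\\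 F_9&=t_1s_2^2+s_3^2-t_2s_1s_2+s_1(L_{123}u+L_{124}v)-s_2(L_{125}u+L_{126}v)+(L_{124}L_{125}-L_{123}L_{126})\Delta\\&\quad-L_{123}\lambda(p_1^2+t_1p_2^2,\,2p_1p_3+2t_1p_2p_4,\,p_3^2+t_1p_4^2)+L_{124}\mu(p_1^2+t_1p_2^2,\,2p_1p_3+2t_1p_2p_4,\,p_3^2+t_1p_4^2)\\&\quad+t_2L_{125}\lambda(p_2^2,2p_2p_4,p_4^2)-t_2L_{126}\mu(p_2^2,2p_2p_4,p_4^2)\\&\quad+\kappa_1(u^2+2t_2p_1p_2)+\kappa_2(uv+t_2(p_2p_3+p_1p_4))+\kappa_3(v^2+2t_2p_3p_4). \end{align*} $\Pi_{\mathbb{A}}^{15}\subset\mathbb{A}^{19}={\rm Spec}\,S_{\Pi}$ is the scheme defined by $I_{\Pi}$ and $R_{\Pi}:=S_{\Pi}/I_{\Pi}$. *)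

(* Defs.v *)
From HB Require Import structures.
From mathcomp Require Import all_boot all_order all_algebra.
From mathcomp Require Import mpoly.
From mathcomp Require Import boolp reals.
From mathcomp Require Import complex.

Set Implicit Arguments.
Unset Strict Implicit.
Unset Printing Implicit Defensive.

Import GRing.Theory.

Local Open Scope ring_scope.

(* Units are defined by the existence of an inverse, because quotient rings
   carry no canonical [unitRingType] structure. *)
Definition is_unit (A : comNzRingType) (a : A) : Prop :=
  exists b : A, b * a = 1.

Definition associated (A : comNzRingType) (a b : A) : Prop :=
  exists2 w : A, is_unit w & b = w * a.

Definition irreducible_elt (A : comNzRingType) (a : A) : Prop :=
  [/\ a <> 0, ~ is_unit a
    & forall b c : A, a = b * c -> is_unit b \/ is_unit c].

Definition is_domain (A : comNzRingType) : Prop :=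
  forall a b : A, a * b = 0 -> a = 0 \/ b = 0.

Definition is_UFD (A : comNzRingType) : Prop :=
  [/\ is_domain A,
      forall a : A, a <> 0 -> ~ is_unit a ->
        exists2 s : seq A, {in s, forall q, irreducible_elt q}
                         & a = \prod_(q <- s) q
    & forall s t : seq A,
        {in s, forall q, irreducible_elt q} ->
        {in t, forall q, irreducible_elt q} ->
        \prod_(q <- s) q = \prod_(q <- t) q ->
        exists t' : seq A,
          [/\ perm_eq t t', size s = size t'
            & forall i, (i < size s)%N -> associated s`_i t'`_i]].

Definition in_generated_ideal (A : comNzRingType) (n : nat) (f : 'I_n -> A)
    (a : A) : Prop :=
  exists c : 'I_n -> A, a = \sum_(i < n) c i * f i.

Section Pi.

Variable K : comNzRingType.

Definition S_Pi : comNzRingType := {mpoly K[19]}.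

Definition Pi_var (k : nat) : S_Pi := ('X_(inord k : 'I_19) : {mpoly K[19]}).

Local Notation p1 := (Pi_var 0).
Local Notation p2 := (Pi_var 1).
Local Notation p3 := (Pi_var 2).
Local Notation p4 := (Pi_var 3).
Local Notation u := (Pi_var 4).
Local Notation v := (Pi_var 5).
Local Notation t1 := (Pi_var 6).
Local Notation t2 := (Pi_var 7).
Local Notation L123 := (Pi_var 8).
Local Notation L124 := (Pi_var 9).
Local Notation L125 := (Pi_var 10).
Local Notation L126 := (Pi_var 11).
Local Notation L135 := (Pi_var 12).
Local Notation L136 := (Pi_var 13).
Local Notation L245 := (Pi_var 14).
Local Notation L246 := (Pi_var 15).
Local Notation s1 := (Pi_var 16).
Local Notation s2 := (Pi_var 17).
Local Notation s3 := (Pi_var 18).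

Definition Delta : S_Pi := p1 * p4 - p2 * p3.

Definition lam (X Y Z : S_Pi) : S_Pi := L136 * X + L245 * Y + L246 * Z.
Definition mu (X Y Z : S_Pi) : S_Pi := L135 * X + L136 * Y + L245 * Z.

Definition U1 : S_Pi := p1 ^+ 2 + t1 * p2 ^+ 2 + p2 * u.
Definition U2 : S_Pi := 2 * p1 * p3 + 2 * t1 * p2 * p4 + p4 * u + p2 * v.
Definition U3 : S_Pi := p3 ^+ 2 + t1 * p4 ^+ 2 + p4 * v.

Definition I1 : S_Pi := t2 * p2 ^+ 2 + p1 * u.
Definition I2 : S_Pi := 2 * t2 * p2 * p4 + p3 * u + p1 * v.
Definition I3 : S_Pi := t2 * p4 ^+ 2 + p3 * v.

Definition W1 : S_Pi := t1 * p2 * u - t2 * p1 * p2 + u ^+ 2.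
Definition W2 : S_Pi :=
  t1 * (p4 * u + p2 * v) - t2 * (p2 * p3 + p1 * p4) + 2 * u * v.
Definition W3 : S_Pi := t1 * p4 * v - t2 * p3 * p4 + v ^+ 2.

Definition kappa1 : S_Pi := L135 * L245 - L136 ^+ 2.
Definition kappa2 : S_Pi := L135 * L246 - L136 * L245.
Definition kappa3 : S_Pi := L136 * L246 - L245 ^+ 2.

Definition F1 : S_Pi :=
  u * s1 - p1 * s2 - p2 * s3 - L126 * Delta - lam U1 U2 U3.

Definition F2 : S_Pi :=
  v * s1 - p3 * s2 - p4 * s3 + L125 * Delta + mu U1 U2 U3.

Definition F3 : S_Pi :=
  - t2 * p2 * s1 + (u + t1 * p2) * s2 - p1 * s3 - L124 * Delta - lam I1 I2 I3.

Definition F4 : S_Pi :=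
  - t2 * p4 * s1 + (v + t1 * p4) * s2 - p3 * s3 + L123 * Delta + mu I1 I2 I3.

Definition F5 : S_Pi :=
  - t2 * p1 * s1 + (t1 * p1 - t2 * p2) * s2 + (u + t1 * p2) * s3
  + L123 * U1 + L124 * (p1 * p3 + t1 * p2 * p4 + p2 * v)
  - L125 * I1 - L126 * (t2 * p2 * p4 + p1 * v) - lam W1 W2 W3.

Definition F6 : S_Pi :=
  - t2 * p3 * s1 + (t1 * p3 - t2 * p4) * s2 + (v + t1 * p4) * s3
  + L123 * (p1 * p3 + t1 * p2 * p4 + p4 * u) + L124 * U3
  - L125 * (t2 * p2 * p4 + p3 * u) - L126 * I3 + mu W1 W2 W3.

Definition F7 : S_Pi :=
  - s2 ^+ 2 + s1 * s3 + (L123 * p2 + L124 * p4) * s1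
  - (L125 * p2 + L126 * p4) * s2
  + L123 * lam (p2 ^+ 2) (2 * p2 * p4) (p4 ^+ 2)
  - L124 * mu (p2 ^+ 2) (2 * p2 * p4) (p4 ^+ 2)
  - L125 * lam (p1 * p2) (p2 * p3 + p1 * p4) (p3 * p4)
  + L126 * mu (p1 * p2) (p2 * p3 + p1 * p4) (p3 * p4)
  + kappa1 * (- p1 ^+ 2 + 2 * u * p2 + t1 * p2 ^+ 2)
  + kappa2 * (- p1 * p3 + u * p4 + v * p2 + t1 * p2 * p4)
  + kappa3 * (- p3 ^+ 2 + 2 * v * p4 + t1 * p4 ^+ 2).

Definition F8 : S_Pi :=
  s2 * s3 + t1 * s1 * s2 - t2 * s1 ^+ 2
  + s1 * (L123 * p1 + L124 * p3) - s2 * (L125 * p1 + L126 * p3)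
  + L123 * lam (p1 * p2) (p1 * p4 + p2 * p3) (p3 * p4)
  - L124 * mu (p1 * p2) (p1 * p4 + p2 * p3) (p3 * p4)
  - L125 * lam (p1 ^+ 2) (2 * p1 * p3) (p3 ^+ 2)
  + L126 * mu (p1 ^+ 2) (2 * p1 * p3) (p3 ^+ 2)
  + kappa1 * (2 * u * p1 + 2 * t1 * p1 * p2 - t2 * p2 ^+ 2)
  + kappa2 * (v * p1 + u * p3 + t1 * (p1 * p4 + p2 * p3) - t2 * p2 * p4)
  + kappa3 * (2 * v * p3 + 2 * t1 * p3 * p4 - t2 * p4 ^+ 2).

Definition F9 : S_Pi :=
  t1 * s2 ^+ 2 + s3 ^+ 2 - t2 * s1 * s2
  + s1 * (L123 * u + L124 * v) - s2 * (L125 * u + L126 * v)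
  + (L124 * L125 - L123 * L126) * Delta
  - L123 * lam (p1 ^+ 2 + t1 * p2 ^+ 2) (2 * p1 * p3 + 2 * t1 * p2 * p4)
               (p3 ^+ 2 + t1 * p4 ^+ 2)
  + L124 * mu (p1 ^+ 2 + t1 * p2 ^+ 2) (2 * p1 * p3 + 2 * t1 * p2 * p4)
              (p3 ^+ 2 + t1 * p4 ^+ 2)
  + t2 * L125 * lam (p2 ^+ 2) (2 * p2 * p4) (p4 ^+ 2)
  - t2 * L126 * mu (p2 ^+ 2) (2 * p2 * p4) (p4 ^+ 2)
  + kappa1 * (u ^+ 2 + 2 * t2 * p1 * p2)
  + kappa2 * (u * v + t2 * (p2 * p3 + p1 * p4))
  + kappa3 * (v ^+ 2 + 2 * t2 * p3 * p4).

Definition Pi_gens (i : 'I_9) : S_Pi :=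
  nth 0 [:: F1; F2; F3; F4; F5; F6; F7; F8; F9] i.

Definition I_Pi (a : S_Pi) : bool := `[< in_generated_ideal Pi_gens a >].

(* The library quotient requires a proper ideal: all the generators vanish
   at the origin. *)
Local Notation ev := (meval (fun=> 0 : K)).

Lemma Pi_gens_eval0 i : ev (Pi_gens i) = 0.
Proof.
have ev0 k : ev (Pi_var k) = 0 by rewrite mevalXU.
have evD (a b : S_Pi) : ev a = 0 -> ev b = 0 -> ev (a + b) = 0.
  by move=> a0 b0; rewrite mevalD a0 b0 addr0.
have evN (a : S_Pi) : ev a = 0 -> ev (- a) = 0.
  by move=> a0; rewrite mevalN a0 oppr0.
have evM (a b : S_Pi) : ev b = 0 -> ev (a * b) = 0.
  by move=> b0; rewrite mevalM b0 mulr0.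
have evX (a : S_Pi) : ev a = 0 -> ev (a ^+ 2) = 0.
  by move=> a0; rewrite expr2 evM.
case: i; do 9?[case=> [|]]; last by [].
all: move=> ? /=; rewrite /Pi_gens /=.
all: rewrite /F1 /F2 /F3 /F4 /F5 /F6 /F7 /F8 /F9 /lam /mu /Delta.
all: rewrite /U1 /U2 /U3 /I1 /I2 /I3 /W1 /W2 /W3.
all: repeat lazymatch goal with
  | |- ev (Pi_var _) = _ => exact: ev0
  | |- ev (_ + _) = _ => apply evD
  | |- ev (- _) = _ => apply evN
  | |- ev (_ ^+ 2) = _ => apply evX
  | |- ev (_ * _) = _ => apply evM
  end.
Qed.

Lemma I_Pi_idealr : idealr_closed I_Pi.
Proof.
split.
- by apply/asboolP; exists (fun=> 0); rewrite big1 // => i _; rewrite mul0r.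
- apply/negP => /asboolP [c] /(congr1 (fun a => ev a)).
  rewrite meval1 raddf_sum big1 => [/eqP|i _ /=]; first by rewrite oner_eq0.
  by rewrite mevalM Pi_gens_eval0 mulr0.
move=> a x y /asboolP [c ->] /asboolP [d ->]; apply/asboolP.
exists (fun i => a * c i + d i); rewrite mulr_sumr -big_split /=.
by apply: eq_bigr => i _; rewrite mulrDl mulrA.
Qed.

HB.instance Definition _ := GRing.isZmodClosed.Build S_Pi I_Pi
  (idealr_closedB I_Pi_idealr).
HB.instance Definition _ := isProperIdeal.Build S_Pi I_Pi
  (idealr_closed_nontrivial I_Pi_idealr).

Definition R_Pi : comNzRingType := {ideal_quot (I_Pi : idealr S_Pi)}.

End Pi.

(* Main.v *)
(* The ring [R] of the theorem becomes a localized polynomial ring when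
   [Delta = p1 p4 - p2 p3] is inverted: the first four relations give
   [L123], [L124], [L125], [L126] over [Delta], and [Delta] times each of the
   other five relations is a combination of these four.  By Nagata's criterion
   it remains to see that [R] is a domain and [Delta] a prime element.

   All relations are homogeneous for suitable positive weights, and modulo the
   fifteen parameters [Pi_par] they only leave a fibre of dimension 7 over the
   field; hence, as in the graded Nakayama lemma, [R] is spanned by the seven
   elements [Pi_basis] over the polynomial ring in the parameters.  These
   elements are independent in the chart [Delta != 0]: after clearing
   denominators, one degenerates the coordinates to a point where the fibre is
   described by explicit 7 x 7 matrices.  So [R] is free over the parameters and
   embeds in the chart, which is a domain.

   Modulo [Delta], inverting [p2] times the value of a binary cubic form at
   [(p2, p4)] again yields a localized polynomial ring, and this element is not
   a zero divisor on the free module [R / Delta R], since the determinant of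
   multiplication by it is not divisible by [Delta]. *)

From HB Require Import structures.
Require Import Defs.
From mathcomp Require Import all_boot all_order all_algebra.
From mathcomp Require Import mpoly.
From mathcomp Require Import ring zify.
From mathcomp Require Import boolp reals complex.

Set Implicit Arguments.
Unset Strict Implicit.
Unset Printing Implicit Defensive.

Import GRing.Theory.

Local Open Scope ring_scope.

(** * Factorization into primes *)

(** The first four relations control the ring only where [Delta] is invertible; the obstacle is that
    an element vanishing in the chart might be nonzero and killed by a power of [Delta]. Freeness
    over the parameters excludes this. As [Delta] is itself a polynomial in the parameters, freeness
    also turns divisibility by [Delta] into divisibility of seven polynomial coordinates. The
    shifted parameters [L246 - v] and [s1 - u] make the fibre over the origin finite: with all
    parameters 0 the relations become, up to sign, u^2, uv, u s2, v s2, u s3 - v^3, v s3, s2^2 - u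
    s3, s2 s3, s3^2. They determine every product of two of u, v, s2, s3 except v^2, and they force
    v^4 = 0; what remains is 1, u, v, s2, s3, v^2, v^3. Generic points of both charts are taken in
    fraction fields of polynomial rings, and nothing is divided by 2 or 3, so the argument holds
    over every field. *)

Definition divides (A : comNzRingType) (a b : A) := exists c : A, b = c * a.

Definition prime_elt (A : comNzRingType) (p : A) :=
  [/\ p <> 0, ~ is_unit p
    & forall a b, divides p (a * b) -> divides p a \/ divides p b].

Definition prime_factorization (A : comNzRingType) (a w : A) (s : seq A) :=
  [/\ is_unit w, {in s, forall q, prime_elt q} & a = w * \prod_(q <- s) q].

Definition prime_factorable (A : comNzRingType) (a : A) :=
  exists w s, prime_factorization a w s.

(** Primes rather than irreducibles: in a domain, uniqueness then follows, so existence is all that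
    has to pass through Gauss's lemma and Nagata's criterion. *)
Definition factorial_ring (A : comNzRingType) :=
  forall a : A, a <> 0 -> prime_factorable a.

Section Factorization.

Variable A : comNzRingType.
Implicit Types (a b p q w x : A) (s t : seq A).

Lemma is_unit1 : is_unit (1 : A).
Proof. by exists 1; rewrite mulr1. Qed.

Lemma is_unitM a b : is_unit a -> is_unit b -> is_unit (a * b).
Proof. by move=> [c ca] [d db]; exists (d * c); rewrite -mulrA (mulrA c) ca mul1r. Qed.

Lemma is_unitMl a b : is_unit (a * b) -> is_unit a.
Proof. by move=> [c cab]; exists (c * b); rewrite -cab -mulrA (mulrC b). Qed.

Lemma is_unitMr a b : is_unit (a * b) -> is_unit b.
Proof. by rewrite mulrC; apply: is_unitMl. Qed.

Lemma dividesxx a : divides a a.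
Proof. by exists 1; rewrite mul1r. Qed.

Lemma divides_mull a b c : divides a c -> divides a (b * c).
Proof. by move=> [d ->]; exists (b * d); rewrite mulrA. Qed.

Lemma divides_mulr a b c : divides a b -> divides a (b * c).
Proof. by rewrite mulrC; apply: divides_mull. Qed.

Lemma divides_trans b a c : divides a b -> divides b c -> divides a c.
Proof. by move=> [d ->] [e ->]; exists (e * d); rewrite mulrA. Qed.

Lemma dividesD a b c : divides a b -> divides a c -> divides a (b + c).
Proof. by move=> [d ->] [e ->]; exists (d + e); rewrite mulrDl. Qed.

Lemma dividesN a b : divides a b -> divides a (- b).
Proof. by move=> [d ->]; exists (- d); rewrite mulNr. Qed.

Lemma dividesB a b c : divides a b -> divides a c -> divides a (b - c).
Proof. by move=> ab ac; apply: dividesD => //; apply: dividesN. Qed.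

Lemma divides_unit a b w : is_unit w -> divides a (w * b) -> divides a b.
Proof. by move=> [c cw] [d wb]; exists (c * d); rewrite -mulrA -wb mulrA cw mul1r. Qed.

Lemma prime_divides_prod p s : prime_elt p -> divides p (\prod_(q <- s) q) ->
  exists2 q, q \in s & divides p q.
Proof.
move=> [_ pU pP]; elim: s => [|q s IH].
  by rewrite big_nil => -[c c1]; case: pU; exists c.
rewrite big_cons => /pP[pq|/IH[r rs pr]]; first by exists q; rewrite ?mem_head.
by exists r => //; rewrite inE rs orbT.
Qed.

Lemma prime_divides_exp p a n : prime_elt p -> divides p (a ^+ n) -> divides p a.
Proof.
move=> pP; elim: n => [|n IH].
  by rewrite expr0 => -[c c1]; case: pP => _ []; exists c.
by rewrite exprS; case: pP => _ _ pM /pM[|/IH].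
Qed.

Lemma prime_factorable_unit w : is_unit w -> prime_factorable w.
Proof. by move=> wU; exists w, [::]; split; rewrite ?big_nil ?mulr1. Qed.

Lemma prime_factorable_prime p : prime_elt p -> prime_factorable p.
Proof.
move=> pP; exists 1, [:: p]; split=> [|q|]; first exact: is_unit1.
  by rewrite inE => /eqP->.
by rewrite big_seq1 mul1r.
Qed.

Lemma prime_factorableM a b :
  prime_factorable a -> prime_factorable b -> prime_factorable (a * b).
Proof.
move=> [w [s [wU sP ->]]] [w' [t [w'U tP ->]]]; exists (w * w'), (s ++ t); split.
- exact: is_unitM.
- by move=> q; rewrite mem_cat => /orP[/sP|/tP].
- by rewrite big_cat mulrACA.
Qed.

Hypothesis domA : is_domain A.

Lemma domain_mulfI a b c : a <> 0 -> a * b = a * c -> b = c.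
Proof.
move=> a0 abc; have /domA[//|/subr0_eq//] : a * (b - c) = 0.
by rewrite mulrBr abc subrr.
Qed.

Lemma domain_mulIf a b c : a <> 0 -> b * a = c * a -> b = c.
Proof. by rewrite ![_ * a]mulrC; apply: domain_mulfI. Qed.

Lemma domain_mulf_neq0 a b : a <> 0 -> b <> 0 -> a * b <> 0.
Proof. by move=> a0 b0 /domA[]. Qed.

Lemma domain_expf_neq0 a n : a <> 0 -> a ^+ n <> 0.
Proof.
move=> a0; elim: n => [|n IH]; first by rewrite expr0; apply/eqP/oner_neq0.
by rewrite exprS; apply: domain_mulf_neq0.
Qed.

(** Each prime of the list divides [x] or [a] and is cancelled there. If all of them went to [a],
    then [x] is a unit; this is what makes the length decrease strictly in [primitive_part]. *)
Lemma prime_factorization_divisor s w x a : is_unit w ->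
  {in s, forall q, prime_elt q} -> x * a = w * \prod_(q <- s) q ->
  exists w' t, [/\ prime_factorization a w' t, (size t <= size s)%N
    & size t = size s -> is_unit x].
Proof.
move=> wU; elim: s x a => [|q s IH] x a sP.
  rewrite big_nil mulr1 => xaw; have xaU : is_unit (x * a) by rewrite xaw.
  exists a, [::]; split=> //; last by move=> _; apply: is_unitMl xaU.
  by split=> //; rewrite ?big_nil ?mulr1 //; apply: is_unitMr xaU.
have [q0 _ qM] := sP q (mem_head _ _).
have {}IH := IH _ _ (fun r rs => sP r (mem_behead (s := q :: s) rs)).
rewrite big_cons mulrCA => xa; have /qM[[x' xE]|[a' aE]] : divides q (x * a).
- by rewrite xa; apply/divides_mulr/dividesxx.
- have /IH[w' [t [pf le_ts _]]] : x' * a = w * \prod_(q <- s) q.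
    by apply: (domain_mulfI q0); rewrite -xa xE; ring.
  exists w', t; split=> //=; first exact: leqW.
  by move=> ts; rewrite ts ltnn in le_ts.
have /IH[w' [t [[w'U tP a'E] le_ts tsU]]] : x * a' = w * \prod_(q <- s) q.
  by apply: (domain_mulfI q0); rewrite -xa aE; ring.
exists w', (q :: t); split=> //; last by move=> [].
split=> // [r|]; first by rewrite inE => /orP[/eqP->|/tP//]; apply: sP; rewrite mem_head.
by rewrite big_cons aE a'E; ring.
Qed.

Lemma prime_factorable_divisor x a :
  prime_factorable (x * a) -> prime_factorable a.
Proof.
move=> [w [s [wU sP /(prime_factorization_divisor wU sP)]]].
by move=> [w' [t [pf _ _]]]; exists w', t.
Qed.

Lemma prime_irreducible p : prime_elt p -> irreducible_elt p.
Proof.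
move=> [p0 pU pM]; split=> // b c pE.
have /pM[[d bE]|[d cE]] : divides p (b * c) by rewrite -pE; apply: dividesxx.
  right; exists d; apply: (domain_mulfI p0); rewrite mulr1 [RHS]pE bE; ring.
left; exists d; apply: (domain_mulfI p0); rewrite mulr1 [RHS]pE cE; ring.
Qed.

Lemma irreducible_prime p : factorial_ring A -> irreducible_elt p -> prime_elt p.
Proof.
move=> facA [p0 pU pI]; have [w [[|q s] [wU sP pE]]] := facA p p0.
  by case: pU; rewrite pE big_nil mulr1.
have [q0 qU qM] := sP q (mem_head _ _).
rewrite big_cons mulrCA in pE; have [//|[c c1]] := pI _ _ pE.
split=> // a b [d abE].
have /qM qab : divides q (a * b).
  by rewrite abE pE; apply/divides_mull/divides_mulr/dividesxx.
have pq : divides p q by exists c; rewrite pE (mulrCA c) c1 mulr1.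
by case: qab => qx; [left|right]; apply: divides_trans qx.
Qed.

Lemma irreducible_associated p q : prime_elt p -> irreducible_elt q ->
  divides p q -> associated p q.
Proof.
move=> [_ pU _] [_ _ qI] [w qE]; exists w => //.
by case: (qI _ _ qE).
Qed.

(** The unit [w] serves the induction: cancelling two associated factors leaves a unit behind. *)
Lemma irreducible_factorization_unique s t w : factorial_ring A -> is_unit w ->
  {in s, forall q, irreducible_elt q} -> {in t, forall q, irreducible_elt q} ->
  \prod_(q <- s) q = w * \prod_(q <- t) q ->
  exists t', [/\ perm_eq t t', size s = size t'
    & forall i, (i < size s)%N -> associated s`_i t'`_i].
Proof.
move=> facA; elim: s t w => [|q s IH] t w wU sI tI.
  rewrite big_nil; case: t tI => [|r t] tI; first by exists [::].
  have [_ rU _] := tI r (mem_head _ _).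
  rewrite big_cons => wr; case: rU; exists (w * \prod_(q <- t) q).
  by rewrite [RHS]wr; ring.
have qP := irreducible_prime facA (sI q (mem_head _ _)); have [q0 qU _] := qP.
rewrite big_cons => stE.
have /(prime_divides_prod qP)[r rt qr] : divides q (\prod_(q <- t) q).
  by apply: (divides_unit wU); rewrite -stE; apply/divides_mulr/dividesxx.
have [x xU rE] := irreducible_associated qP (tI r rt) qr.
have perm_t := perm_to_rem rt.
have [||| t' [perm_t' sz_t' t'P]] := IH (rem r t) (w * x) (is_unitM wU xU).
- by move=> z zs; apply: sI; rewrite inE zs orbT.
- by move=> z /mem_rem; apply: tI.
- apply: (domain_mulfI q0); rewrite stE (perm_big _ perm_t) big_cons /= rE; ring.
exists (r :: t'); split=> /=; last 2 first.
- by rewrite sz_t'.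
- by case=> [|i] lt_i; [exists x|apply: t'P].
by apply: perm_trans perm_t _; rewrite perm_cons.
Qed.

Theorem factorial_UFD : factorial_ring A -> is_UFD A.
Proof.
move=> facA; split=> // [a a0 aU|s t sI tI stE]; last first.
  by apply: (irreducible_factorization_unique facA is_unit1) => //; rewrite mul1r.
have [w [[|q s] [wU sP aE]]] := facA a a0.
  by case: aU; rewrite aE big_nil mulr1.
have [q0 qU qM] := sP q (mem_head _ _); have [c cw] := wU.
(* A factorization in [is_UFD] has no separate unit, so [w] is absorbed by the first prime. *)
exists (w * q :: s) => [r|]; last by rewrite aE !big_cons mulrA.
rewrite inE => /orP[/eqP->|rs]; last first.
  by apply/prime_irreducible/sP; rewrite inE rs orbT.
apply: prime_irreducible; split; last 1 first.
- move=> x y [z xyE]; have [] : divides q x \/ divides q y.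
  + by apply: qM; exists (z * w); rewrite xyE; ring.
  + by move=> [e ->]; left; exists (e * c); rewrite -mulrA (mulrA c) cw mul1r.
  + by move=> [e ->]; right; exists (e * c); rewrite -mulrA (mulrA c) cw mul1r.
- move=> wq0; apply: q0; have -> : q = c * (w * q) by rewrite mulrA cw mul1r.
  by rewrite wq0 mulr0.
- by move/is_unitMr.
Qed.

End Factorization.

(** * Nagata's criterion *)

(* [B] stands for a subring of [R] with the same
   localization at [d], so that no localized ring has to be built. *)
Section Nagata.

Variables (R B : comNzRingType) (iota : {rmorphism B -> R}) (delta : B).

Hypothesis domR : is_domain R.
Hypothesis iota_inj : injective iota.
Hypothesis delta_prime : prime_elt (iota delta).
Hypothesis delta_separated :
  forall a : R, a <> 0 -> exists n, ~ divides (iota delta ^+ n) a.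
Hypothesis delta_clear :
  forall a : R, exists n b, iota delta ^+ n * a = iota b.

(** A product divisible by [q'] is moved into [B] by a power of [delta], where [q] divides one of
    the factors. Back in [R], the powers of [delta] are stripped, because [delta] is prime there and
    does not divide [q']. *)
Lemma nagata_prime (q : B) (q' : R) m : prime_elt q -> ~ divides q delta ->
  iota q = iota delta ^+ m * q' -> ~ divides (iota delta) q' ->
  ~ is_unit q' -> prime_elt q'.
Proof.
have [d0 _ dM] := delta_prime; move=> qP qd qE dq' q'U.
have q'0 : q' <> 0 by move=> q'0; case: dq'; exists 0; rewrite mul0r.
split=> // f g [h fgE].
have [a [F FE]] := delta_clear f; have [b [G GE]] := delta_clear g.
have [c [H HE]] := delta_clear h.
have q'_of (x : R) (X : B) k : iota delta ^+ k * x = iota X -> divides q X ->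
    divides q' x.
  move=> XE [Y XqE]; have : exists z, iota delta ^+ k * x = z * q'.
    by exists (iota Y * iota delta ^+ m); rewrite XE XqE rmorphM qE mulrA.
  elim: k x {XE} => [|k IH] x [z xE]; first by exists z; rewrite -xE mul1r.
  rewrite exprS -mulrA in xE.
  have [|[w zE]|//] := dM z q'; first by exists (iota delta ^+ k * x); rewrite -xE mulrC.
  by apply: IH; exists w; apply: (domain_mulfI domR d0); rewrite xE zE; ring.
have : divides q ((F * G) * delta ^+ (c + m)).
  exists (H * delta ^+ (a + b)); apply: iota_inj.
  rewrite !rmorphM !rmorphXn -FE -GE -HE qE !exprD /=.
  have -> : iota delta ^+ a * f * (iota delta ^+ b * g) =
            iota delta ^+ a * iota delta ^+ b * (f * g) by ring.
  by rewrite fgE; ring.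
have [_ _ qM] := qP; case/qM => [/qM[qF|qG]|/(prime_divides_exp qP)//].
  by left; apply: q'_of FE qF.
by right; apply: q'_of GE qG.
Qed.

Lemma nagata_prime_factorable (q : B) :
  prime_elt q -> prime_factorable (iota q).
Proof.
have [d0 dU dM] := delta_prime; move=> qP; have [q0 _ _] := qP.
have [[h dE]|qd] := EM (divides q delta).
  have dE' : iota delta = iota h * iota q by rewrite dE rmorphM.
  by apply: (prime_factorable_divisor domR (x := iota h)); rewrite -dE';
     apply: prime_factorable_prime.
have iq0 : iota q <> 0 by rewrite -(rmorph0 iota) => /iota_inj.
pose Q n := `[< ~ divides (iota delta ^+ n) (iota q) >].
have exQ : exists n, Q n by have [n nP] := delta_separated iq0; exists n; apply/asboolP.
(* The least power of [delta] not dividing [iota q] is a positive one, since [delta ^+ 0 = 1]; its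
   predecessor is the exact power to split off. *)
case: (ex_minnP exQ) => -[|m] /asboolP Qm minQ.
  by case: Qm; rewrite expr0; exists (iota q); rewrite mulr1.
have [q' qE] : divides (iota delta ^+ m) (iota q).
  have [//|nd] := EM (divides (iota delta ^+ m) (iota q)).
  by have /minQ : Q m by [apply/asboolP]; rewrite ltnn.
rewrite qE mulrC; apply: prime_factorableM.
  elim: (m) => [|k IH]; first exact/prime_factorable_unit/is_unit1.
  by rewrite exprS; apply: prime_factorableM IH; apply: prime_factorable_prime.
have [|q'U] := EM (is_unit q'); first exact: prime_factorable_unit.
apply: prime_factorable_prime; apply: (nagata_prime qP qd (m := m)) => //.
  by rewrite qE mulrC.
by move=> [z q'E]; apply: Qm; exists z; rewrite qE q'E exprS; ring.
Qed.

Theorem nagata : factorial_ring B -> factorial_ring R.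
Proof.
move=> facB a a0; have [n [b bE]] := delta_clear a.
have [d0 _ _] := delta_prime.
apply: (prime_factorable_divisor domR (x := iota delta ^+ n)); rewrite bE.
have /facB[w [s [[c cw] sP ->]]] : b <> 0.
  move=> b0; rewrite b0 rmorph0 in bE.
  exact: (domain_mulf_neq0 domR (domain_expf_neq0 domR (n := n) d0) a0 bE).
rewrite rmorphM rmorph_prod; apply: prime_factorableM.
  by apply: prime_factorable_unit; exists (iota c); rewrite -rmorphM cw rmorph1.
elim: s sP => [|q s IH] sP; first by rewrite big_nil; apply/prime_factorable_unit/is_unit1.
rewrite big_cons; apply: prime_factorableM.
  by apply/nagata_prime_factorable/sP/mem_head.
by apply: IH => r rs; apply: sP; rewrite inE rs orbT.
Qed.

End Nagata.

Lemma idomain_is_domain (A : idomainType) : is_domain A.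
Proof. by move=> a b /eqP; rewrite mulf_eq0 => /orP[]/eqP->; [left|right]. Qed.

(** * Transport of factorizations along an isomorphism *)

Section Isomorphism.

Variables (A B : comNzRingType) (f : {rmorphism A -> B}) (g : B -> A).
Hypotheses (fK : cancel f g) (gK : cancel g f).

Lemma iso_is_unit a : is_unit (f a) <-> is_unit a.
Proof.
split=> -[b ba]; last by exists (f b); rewrite -rmorphM ba rmorph1.
by exists (g b); apply: (can_inj fK); rewrite rmorphM gK ba rmorph1.
Qed.

Lemma iso_divides a b : divides (f a) (f b) <-> divides a b.
Proof.
split=> -[c cE]; last by exists (f c); rewrite cE rmorphM.
by exists (g c); apply: (can_inj fK); rewrite rmorphM gK.
Qed.

Lemma iso_prime a : prime_elt (f a) <-> prime_elt a.
Proof.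
split=> -[a0 aU aM]; split.
- by move=> a_0; apply: a0; rewrite a_0 rmorph0.
- by move/iso_is_unit.
- by move=> b c /iso_divides; rewrite rmorphM => /aM[]/iso_divides; [left|right].
- by rewrite -(rmorph0 f) => /(can_inj fK).
- by move/iso_is_unit.
- move=> b c; rewrite -(gK b) -(gK c) -rmorphM => /iso_divides/aM.
  by move=> [] /iso_divides; [left|right].
Qed.

Lemma iso_factorial : factorial_ring A -> factorial_ring B.
Proof.
move=> facA b b0; have /facA[w [s [wU sP bE]]] : g b <> 0.
  by move=> gb0; apply: b0; rewrite -(gK b) gb0 rmorph0.
exists (f w), (map f s); split; first exact/iso_is_unit.
  by move=> _ /mapP[q /sP qP ->]; apply/iso_prime.
by rewrite big_map -rmorph_prod -rmorphM -bE gK.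
Qed.

End Isomorphism.

(** * Gauss's lemma *)

Section Gauss.

Variable A : idomainType.
Implicit Types (f g h k : {poly A}) (a p : A).

Lemma divides_polyC_coef a f i : divides a%:P f -> divides a f`_i.
Proof. by move=> [c ->]; rewrite coefMC; exists c`_i. Qed.

Lemma polyC_is_unit a : is_unit a%:P -> is_unit a.
Proof.
move=> [c /polyP/(_ 0)]; rewrite coefMC coefC /= => ca.
by exists c`_0.
Qed.

(** This amounts to (A/p)[X] being a domain, but avoids the quotient: [p] divides the product of the
    leading coefficients, hence one of them, and that leading term is removed. The induction is on
    the sum of the sizes. *)
Lemma polyC_prime p : prime_elt p -> prime_elt p%:P.
Proof.
move=> [p0 pU pM]; split; first by move/eqP; rewrite polyC_eq0 => /eqP.
  by move/polyC_is_unit.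
move=> f g; have [n] := ubnP (size f + size g)%N.
elim: n f g => // n IH f g; rewrite ltnS => le_n pfg.
have [->|f0] := eqVneq f 0; first by left; exists 0; rewrite mul0r.
have [->|g0] := eqVneq g 0; first by right; exists 0; rewrite mul0r.
pose tl h := h - lead_coef h *: 'X^((size h).-1).
have lt_tl h : h != 0 -> (size (tl h) < size h)%N.
  move=> h0; have sz_h : (size h).-1.+1 = size h by rewrite prednK ?size_poly_gt0.
  rewrite -sz_h ltnS; apply/leq_sizeP => j le_j; rewrite coefB coefZ coefXn.
  move: le_j; rewrite leq_eqVlt => /orP[/eqP<-|lt_j]; first by rewrite eqxx mulr1 subrr.
  by rewrite gtn_eqF // mulr0 subr0 nth_default // -sz_h.
have tlD h : h = tl h + lead_coef h *: 'X^((size h).-1) by rewrite subrK.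
have lcd h : divides p (lead_coef h) -> divides p%:P (lead_coef h *: 'X^((size h).-1)).
  by move=> [c ->]; exists (c *: 'X^((size h).-1)); rewrite -scalerAl ['X^_ * _]mulrC mul_polyC scalerA.
have : divides p (lead_coef f * lead_coef g).
  by rewrite -lead_coefM; apply: divides_polyC_coef.
case/pM => /lcd pl.
  have [||pf|pg] := IH (tl f) g; last by right.
  - by apply: leq_trans le_n; rewrite ltn_add2r lt_tl.
  - by rewrite /tl mulrBl; apply: dividesB => //; apply: divides_mulr.
  - by left; rewrite (tlD f); apply: dividesD.
have [||pf|pg] := IH f (tl g); last 2 first.
- by left.
- by right; rewrite (tlD g); apply: dividesD.
- by apply: leq_trans le_n; rewrite ltn_add2l lt_tl.
- by rewrite /tl mulrBr; apply: dividesB => //; apply: divides_mull.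
Qed.

Definition primitive g := forall p : A, prime_elt p -> ~ divides p%:P g.

Hypothesis facA : factorial_ring A.

(** The primes of [a] remain prime as constant polynomials and do not divide [g], so they are
    cancelled from [r] one at a time. *)
Lemma primitive_divides g k r a : primitive g -> a <> 0 ->
  a *: k = r * g -> divides g k.
Proof.
move=> gP /facA[w [s [[c cw] sP ->]]].
elim: s k r sP => [|q s IH] k r sP.
  rewrite big_nil mulr1 => kE; exists (c *: r).
  by rewrite -scalerAl -kE scalerA cw scale1r.
have qP := sP q (mem_head _ _); rewrite big_cons mulrCA -scalerA => kE.
have [q0 _ qM] := polyC_prime qP.
have [|[r' rE]|/(gP q qP)//] := qM r g.
  by rewrite -kE -mul_polyC mulrC; exists ((w * \prod_(j <- s) j) *: k).
apply: (IH k r'); first by move=> z zs; apply: sP; rewrite inE zs orbT.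
apply: (domain_mulfI (@idomain_is_domain _) q0); rewrite mul_polyC kE rE; ring.
Qed.

(** The hypothesis on [h], [k], [a] expresses irreducibility over the field of fractions without
    forming that field. Gcds by pseudo-division replace those over the field; the scalars they
    introduce are removed by [primitive_divides]. *)
Lemma primitive_prime g : (1 < size g)%N -> primitive g ->
  (forall h k a, a <> 0 -> a *: g = h * k -> (size h <= 1)%N \/ (size k <= 1)%N) ->
  prime_elt g.
Proof.
move=> sz_g gP gI; split=> [g0|[c]|h k [r hkE]].
- by rewrite g0 size_poly0 in sz_g.
- move/(congr1 (size : {poly A} -> nat)); rewrite size_poly1 => sz1.
  have c0 : c != 0 by apply: contra_eqN sz1 => /eqP->; rewrite mul0r size_poly0.
  have g0 : g != 0 by rewrite -size_poly_gt0 ltnW.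
  rewrite size_mul // in sz1; have := c0; rewrite -size_poly_gt0 => c_gt0.
  by move: sz_g sz1 c_gt0; case: (size c) => [|m]; case: (size g) => [|[|l]]; rewrite ?addnS.
have [gh|ngh] := boolP (coprimep g h).
  right; have : (g %| k)%R by rewrite -(Pdiv.Idomain.Gauss_dvdpr k gh) hkE dvdp_mull.
  move=> /Pdiv.Idomain.dvdpP[[b r'] /= /eqP b0 kE].
  exact: primitive_divides kE.
left; have /Pdiv.Idomain.dvdpP[[b q] /= b0 gE] := dvdp_gcdl g h.
have /Pdiv.Idomain.dvdpP[[b' q'] /= b'0 hE] := dvdp_gcdr g h.
have /eqP/gI/(_ gE)[sz_q|sz_d] := b0; last first.
  have g0 : g != 0 by rewrite -size_poly_gt0 ltnW.
  move: ngh; rewrite /coprimep eqn_leq sz_d /= size_poly_gt0.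
  by rewrite gcdp_eq0 negb_and g0.
have [c qE] : exists c, q = c%:P by exists q`_0; apply: size1_polyC.
have c0 : c != 0.
  apply: contra_eqN gE => /eqP c0; rewrite qE c0 polyC0 mul0r -mul_polyC.
  by rewrite mulf_neq0 ?polyC_eq0 // -size_poly_gt0 ltnW.
apply: (primitive_divides (a := c * b') (r := b *: q')) => //.
  by apply/eqP; rewrite mulf_neq0.
rewrite -mul_polyC qE in gE.
by rewrite -scalerA hE -!mul_polyC mulrCA -gE; ring.
Qed.

(** The content is extracted prime by prime; each extraction shortens a prime factorization of the
    leading coefficient, so gcds of coefficients are avoided. *)
Lemma primitive_part f : f <> 0 -> exists a g, [/\ a <> 0, primitive g & f = a *: g].
Proof.
move=> f0; have lf0 : lead_coef f <> 0 by apply/eqP; rewrite lead_coef_eq0; apply/eqP.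
have [w [s [wU sP fE]]] := facA lf0.
have [n] := ubnP (size s); elim: n f s w f0 lf0 wU sP fE => // n IH f s w f0 lf0 wU sP fE le_s.
have [fP|] := EM (primitive f).
  by exists 1, f; split=> //; [apply/eqP/oner_neq0 | rewrite scale1r].
move=> /existsNP[p /not_implyP[pP /contrapT[g gE]]].
have [p0 pU _] := pP; have dom := @idomain_is_domain A.
have fgE : f = p *: g by rewrite gE mulrC mul_polyC.
have g0 : g <> 0 by move=> g0; apply: f0; rewrite fgE g0 scaler0.
have lg0 : lead_coef g <> 0 by apply/eqP; rewrite lead_coef_eq0; apply/eqP.
rewrite fgE lead_coefZ in fE.
have [w' [t [[w'U tP lgE] le_t tsU]]] := prime_factorization_divisor dom wU sP fE.
have [|a [h [a0 hP hE]]] := IH g t w' g0 lg0 w'U tP lgE.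
  rewrite -ltnS; apply: leq_trans le_s; rewrite ltnS ltn_neqAle le_t andbT.
  by apply/eqP => /tsU.
exists (p * a), h; split=> //; last by rewrite fgE hE scalerA.
exact: domain_mulf_neq0.
Qed.

Lemma polyC_prime_factorable a : a <> 0 -> prime_factorable a%:P.
Proof.
move=> /facA[w [s [[c cw] sP ->]]]; exists w%:P, (map polyC s); split.
- by exists c%:P; rewrite -polyCM cw.
- by move=> _ /mapP[q /sP qP ->]; apply: polyC_prime.
- by rewrite big_map -rmorph_prod -polyCM.
Qed.

Theorem poly_factorial : factorial_ring {poly A}.
Proof.
move=> f; have [n] := ubnP (size f); elim: n f => // n IH f; rewrite ltnS => le_n f0.
have [a [g [a0 gP fE]]] := primitive_part f0.
have sz_fg : size f = size g by rewrite fE size_scale //; apply/eqP.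
rewrite fE -mul_polyC; apply: prime_factorableM; first exact: polyC_prime_factorable.
have g0 : g <> 0 by move=> g0; apply: f0; rewrite fE g0 scaler0.
have [sz_g|sz_g] := leqP (size g) 1.
  rewrite (size1_polyC sz_g); apply: polyC_prime_factorable => c0.
  by apply: g0; rewrite (size1_polyC sz_g) c0.
have [gI|] := EM (forall h k a, a <> 0 -> a *: g = h * k ->
                   (size h <= 1)%N \/ (size k <= 1)%N).
  exact/prime_factorable_prime/primitive_prime.
move=> /existsNP[h /existsNP[k /existsNP[b /not_implyP[b0 /not_implyP[bE]]]]].
move=> /not_orP[/negP sz_h /negP sz_k]; rewrite -!ltnNge in sz_h sz_k.
have h0 : h != 0 by rewrite -size_poly_gt0 ltnW.
have k0 : k != 0 by rewrite -size_poly_gt0 ltnW.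
have sz_hk : size g = (size h + size k).-1.
  by rewrite -size_mul // -bE size_scale //; apply/eqP.
(* Only the multiple [b *: g] splits as [h * k]; factorability descends to its divisor [g]. *)
apply: (prime_factorable_divisor (@idomain_is_domain _) (x := b%:P)).
rewrite mul_polyC bE; apply: prime_factorableM; apply: IH; try exact/eqP.
  apply: leq_trans le_n; rewrite sz_fg sz_hk.
  by case: (size k) sz_k => [|[|l]] // _; rewrite !addnS /= ltnS leq_addr.
apply: leq_trans le_n; rewrite sz_fg sz_hk.
by case: (size h) sz_h => [|[|l]] // _; rewrite !addSn /= ltnS leq_addl.
Qed.

Lemma linear_prime a b : a <> 0 ->
  (forall p, prime_elt p -> divides p a -> ~ divides p b) ->
  prime_elt (a *: 'X + b%:P).
Proof.
move=> /eqP a0 ab; have sz : size (a *: 'X + b%:P) = 2.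
  by rewrite -mul_polyC size_MXaddC polyC_eq0 (negPf a0) size_polyC a0.
apply: primitive_prime; first by rewrite sz.
  move=> p pP pd; apply: (ab p pP).
    by have := divides_polyC_coef 1 pd; rewrite coefD coefZ coefX coefC mulr1 addr0.
  by have := divides_polyC_coef 0 pd; rewrite coefD coefZ coefX coefC mulr0 add0r.
move=> h k c /eqP c0 cE; apply/orP; apply: contraTT isT; rewrite negb_or -!ltnNge => /andP[h1 k1].
have := congr1 (size : {poly A} -> nat) cE.
rewrite size_scale // sz size_mul -?size_poly_gt0 1?ltnW //.
by case: (size h) (size k) h1 k1 => [|[|x]] // [|[|y]] //; rewrite !addnS.
Qed.

End Gauss.

(** * Polynomial rings in several variables *)

Section MPoly.

Variables (K : comNzRingType) (n : nat).

Lemma mpoly_gen_ind (Q : {mpoly K[n]} -> Prop) :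
  (forall c, Q c%:MP) -> (forall i, Q 'X_i) ->
  (forall f g, Q f -> Q g -> Q (f + g)) ->
  (forall f g, Q f -> Q g -> Q (f * g)) -> forall f, Q f.
Proof.
move=> QC QX QD QM; elim/mpolyind => [|c m f _ _ Qf]; first by rewrite -mpolyC0.
apply: (QD) => //; rewrite -mul_mpolyC; apply: (QM) => //.
rewrite mpolyXE_id; apply: (big_ind Q) => [|x y|i _]; [by rewrite -mpolyC1|exact: QM|].
elim: (m i) => [|k IH]; first by rewrite expr0 -mpolyC1.
by rewrite exprS; apply: (QM).
Qed.

Lemma mpoly_hom_ext (E : nzRingType) (f g : {rmorphism {mpoly K[n]} -> E}) :
  (forall c, f c%:MP = g c%:MP) -> (forall i, f 'X_i = g 'X_i) -> f =1 g.
Proof.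
move=> fgC fgX; elim/mpoly_gen_ind => // p q fgp fgq.
  by rewrite !rmorphD fgp fgq.
by rewrite !rmorphM fgp fgq.
Qed.

End MPoly.

Section MPolyPoly.

Variables (K : comNzRingType) (n : nat).

(** The variable split off is the last one; among the fifteen chart coordinates this is p3, in which
    [Delta] is linear. *)
Definition mpoly_to_poly : {mpoly K[n.+1]} -> {poly {mpoly K[n]}} :=
  mmap (polyC \o @mpolyC n K)
    (fun i => if unlift ord_max i is Some j then ('X_j)%:P else 'X).

HB.instance Definition _ := GRing.RMorphism.on mpoly_to_poly.

Definition poly_to_mpoly : {poly {mpoly K[n]}} -> {mpoly K[n.+1]} :=
  horner_eval 'X_ord_max \o
    map_poly (mmap (@mpolyC n.+1 K) (fun j => 'X_(lift ord_max j))).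

HB.instance Definition _ := GRing.RMorphism.on poly_to_mpoly.

Lemma mpoly_to_polyC c : mpoly_to_poly c%:MP = c%:MP%:P.
Proof. by rewrite /mpoly_to_poly mmapC. Qed.

Lemma mpoly_to_poly_lift j : mpoly_to_poly 'X_(lift ord_max j) = ('X_j)%:P.
Proof. by rewrite /mpoly_to_poly mmapX mmap1U liftK. Qed.

Lemma mpoly_to_poly_max : mpoly_to_poly 'X_ord_max = 'X.
Proof. by rewrite /mpoly_to_poly mmapX mmap1U unlift_none. Qed.

Lemma poly_to_mpolyC c : poly_to_mpoly c%:P =
  mmap (@mpolyC n.+1 K) (fun j => 'X_(lift ord_max j)) c.
Proof. by rewrite /poly_to_mpoly /= map_polyC /= /horner_eval hornerC. Qed.

Lemma poly_to_mpolyX : poly_to_mpoly 'X = 'X_ord_max.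
Proof. by rewrite /poly_to_mpoly /= map_polyX /horner_eval hornerX. Qed.

Lemma mpoly_to_polyK : cancel mpoly_to_poly poly_to_mpoly.
Proof.
apply: (@mpoly_hom_ext _ _ _ (poly_to_mpoly \o mpoly_to_poly) idfun) => [c|i] /=.
  by rewrite mpoly_to_polyC poly_to_mpolyC mmapC.
case: (unliftP ord_max i) => [j ->|->].
  by rewrite mpoly_to_poly_lift poly_to_mpolyC mmapX mmap1U.
by rewrite mpoly_to_poly_max poly_to_mpolyX.
Qed.

Lemma poly_to_mpolyK : cancel poly_to_mpoly mpoly_to_poly.
Proof.
have CK c : mpoly_to_poly (poly_to_mpoly c%:P) = c%:P.
  apply: (@mpoly_hom_ext _ _ _ (mpoly_to_poly \o poly_to_mpoly \o polyC) polyC).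
    by move=> a /=; rewrite poly_to_mpolyC mmapC mpoly_to_polyC.
  by move=> i /=; rewrite poly_to_mpolyC mmapX mmap1U mpoly_to_poly_lift.
elim/poly_ind => [|f c IH]; first by rewrite !rmorph0.
by rewrite !(rmorphD, rmorphM) /= IH CK poly_to_mpolyX mpoly_to_poly_max.
Qed.

End MPolyPoly.

Theorem mpoly_factorial (K : fieldType) n : factorial_ring {mpoly K[n]}.
Proof.
elim: n => [|n IH].
  have mpoly0E (f : {mpoly K[0]}) : exists c, f = c%:MP.
    elim/mpoly_gen_ind: f => [c||_ _ [a ->] [b ->]|_ _ [a ->] [b ->]].
    - by exists c.
    - by case.
    - by exists (a + b); rewrite mpolyCD.
    - by exists (a * b); rewrite mpolyCM.
  move=> f; have [c ->] := mpoly0E f => /eqP; rewrite mpolyC_eq0 => c0.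
  by apply: prime_factorable_unit; exists c^-1%:MP; rewrite -mpolyCM mulVf.
apply: (@iso_factorial _ _ (@poly_to_mpoly K n) (@mpoly_to_poly K n)).
- exact: poly_to_mpolyK.
- exact: mpoly_to_polyK.
- exact: (@poly_factorial {mpoly K[n]}).
Qed.

(** * The relations and the two charts *)

Section Relations.

Variables (A : comNzRingType) (x : nat -> A).

Local Notation p1 := (x 0%N).
Local Notation p2 := (x 1%N).
Local Notation p3 := (x 2%N).
Local Notation p4 := (x 3%N).
Local Notation u := (x 4%N).
Local Notation v := (x 5%N).
Local Notation t1 := (x 6%N).
Local Notation t2 := (x 7%N).
Local Notation L123 := (x 8%N).
Local Notation L124 := (x 9%N).
Local Notation L125 := (x 10%N).
Local Notation L126 := (x 11%N).
Local Notation L135 := (x 12%N).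
Local Notation L136 := (x 13%N).
Local Notation L245 := (x 14%N).
Local Notation L246 := (x 15%N).
Local Notation s1 := (x 16%N).
Local Notation s2 := (x 17%N).
Local Notation s3 := (x 18%N).
Local Notation Dl := (p1 * p4 - p2 * p3).
Local Notation la X Y Z := (L136 * X + L245 * Y + L246 * Z).
Local Notation mu X Y Z := (L135 * X + L136 * Y + L245 * Z).
Local Notation u1 := (p1 ^+ 2 + t1 * p2 ^+ 2 + p2 * u).
Local Notation u2 := (2 * p1 * p3 + 2 * t1 * p2 * p4 + p4 * u + p2 * v).
Local Notation u3 := (p3 ^+ 2 + t1 * p4 ^+ 2 + p4 * v).
Local Notation i1 := (t2 * p2 ^+ 2 + p1 * u).
Local Notation i2 := (2 * t2 * p2 * p4 + p3 * u + p1 * v).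
Local Notation i3 := (t2 * p4 ^+ 2 + p3 * v).
Local Notation w1 := (t1 * p2 * u - t2 * p1 * p2 + u ^+ 2).
Local Notation w2 :=
  (t1 * (p4 * u + p2 * v) - t2 * (p2 * p3 + p1 * p4) + 2 * u * v).
Local Notation w3 := (t1 * p4 * v - t2 * p3 * p4 + v ^+ 2).
Local Notation k1 := (L135 * L245 - L136 ^+ 2).
Local Notation k2 := (L135 * L246 - L136 * L245).
Local Notation k3 := (L136 * L246 - L245 ^+ 2).

(** The relations are stated at an arbitrary point of an arbitrary ring, so that the same identities
    serve in the coordinate ring and at the generic points of both charts. *)
Definition rel1 := u * s1 - p1 * s2 - p2 * s3 - L126 * Dl - la u1 u2 u3.
Definition rel2 := v * s1 - p3 * s2 - p4 * s3 + L125 * Dl + mu u1 u2 u3.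
Definition rel3 :=
  - t2 * p2 * s1 + (u + t1 * p2) * s2 - p1 * s3 - L124 * Dl - la i1 i2 i3.
Definition rel4 :=
  - t2 * p4 * s1 + (v + t1 * p4) * s2 - p3 * s3 + L123 * Dl + mu i1 i2 i3.
Definition rel5 :=
  - t2 * p1 * s1 + (t1 * p1 - t2 * p2) * s2 + (u + t1 * p2) * s3
  + L123 * u1 + L124 * (p1 * p3 + t1 * p2 * p4 + p2 * v)
  - L125 * i1 - L126 * (t2 * p2 * p4 + p1 * v) - la w1 w2 w3.
Definition rel6 :=
  - t2 * p3 * s1 + (t1 * p3 - t2 * p4) * s2 + (v + t1 * p4) * s3
  + L123 * (p1 * p3 + t1 * p2 * p4 + p4 * u) + L124 * u3
  - L125 * (t2 * p2 * p4 + p3 * u) - L126 * i3 + mu w1 w2 w3.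
Definition rel7 :=
  - s2 ^+ 2 + s1 * s3 + (L123 * p2 + L124 * p4) * s1
  - (L125 * p2 + L126 * p4) * s2
  + L123 * la (p2 ^+ 2) (2 * p2 * p4) (p4 ^+ 2)
  - L124 * mu (p2 ^+ 2) (2 * p2 * p4) (p4 ^+ 2)
  - L125 * la (p1 * p2) (p2 * p3 + p1 * p4) (p3 * p4)
  + L126 * mu (p1 * p2) (p2 * p3 + p1 * p4) (p3 * p4)
  + k1 * (- p1 ^+ 2 + 2 * u * p2 + t1 * p2 ^+ 2)
  + k2 * (- p1 * p3 + u * p4 + v * p2 + t1 * p2 * p4)
  + k3 * (- p3 ^+ 2 + 2 * v * p4 + t1 * p4 ^+ 2).
Definition rel8 :=
  s2 * s3 + t1 * s1 * s2 - t2 * s1 ^+ 2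
  + s1 * (L123 * p1 + L124 * p3) - s2 * (L125 * p1 + L126 * p3)
  + L123 * la (p1 * p2) (p1 * p4 + p2 * p3) (p3 * p4)
  - L124 * mu (p1 * p2) (p1 * p4 + p2 * p3) (p3 * p4)
  - L125 * la (p1 ^+ 2) (2 * p1 * p3) (p3 ^+ 2)
  + L126 * mu (p1 ^+ 2) (2 * p1 * p3) (p3 ^+ 2)
  + k1 * (2 * u * p1 + 2 * t1 * p1 * p2 - t2 * p2 ^+ 2)
  + k2 * (v * p1 + u * p3 + t1 * (p1 * p4 + p2 * p3) - t2 * p2 * p4)
  + k3 * (2 * v * p3 + 2 * t1 * p3 * p4 - t2 * p4 ^+ 2).
Definition rel9 :=
  t1 * s2 ^+ 2 + s3 ^+ 2 - t2 * s1 * s2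
  + s1 * (L123 * u + L124 * v) - s2 * (L125 * u + L126 * v)
  + (L124 * L125 - L123 * L126) * Dl
  - L123 * la (p1 ^+ 2 + t1 * p2 ^+ 2) (2 * p1 * p3 + 2 * t1 * p2 * p4)
              (p3 ^+ 2 + t1 * p4 ^+ 2)
  + L124 * mu (p1 ^+ 2 + t1 * p2 ^+ 2) (2 * p1 * p3 + 2 * t1 * p2 * p4)
              (p3 ^+ 2 + t1 * p4 ^+ 2)
  + t2 * L125 * la (p2 ^+ 2) (2 * p2 * p4) (p4 ^+ 2)
  - t2 * L126 * mu (p2 ^+ 2) (2 * p2 * p4) (p4 ^+ 2)
  + k1 * (u ^+ 2 + 2 * t2 * p1 * p2)
  + k2 * (u * v + t2 * (p2 * p3 + p1 * p4))
  + k3 * (v ^+ 2 + 2 * t2 * p3 * p4).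

Definition rels := [:: rel1; rel2; rel3; rel4; rel5; rel6; rel7; rel8; rel9].

(** For [k] at least 9 the default value 0 makes the condition empty. *)
Definition Pi_point := forall k, rels`_k = 0.

Section PlueckerChart.

Hypotheses (domA : is_domain A) (Dl0 : Dl <> 0).
Hypotheses (r1 : rel1 = 0) (r2 : rel2 = 0) (r3 : rel3 = 0) (r4 : rel4 = 0).

Lemma Pi_point_of_Delta : Pi_point.
Proof.
have cancel_Dl b a1 a2 a3 a4 :
    Dl * b = a1 * rel1 + a2 * rel2 + a3 * rel3 + a4 * rel4 -> b = 0.
  by rewrite r1 r2 r3 r4 !mulr0 !addr0 => /domA[].
(* The coefficients come from eliminating L123, L124, L125, L126: up to sign and modulo the first
   four relations, each is the factor by which the corresponding variable is multiplied in the
   relation at hand. *)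
have r5 : rel5 = 0.
  apply: (cancel_Dl _ (p1 * v + p2 * p4 * t2) (- p1 * u - p2 ^+ 2 * t2)
    (- p1 * p3 - p2 * p4 * t1 - p2 * v) (p1 ^+ 2 + p2 ^+ 2 * t1 + p2 * u)).
  by rewrite /rel1 /rel2 /rel3 /rel4 /rel5; ring.
have r6 : rel6 = 0.
  apply: (cancel_Dl _ (p3 * v + p4 ^+ 2 * t2) (- p2 * p4 * t2 - p3 * u)
    (- p3 ^+ 2 - p4 ^+ 2 * t1 - p4 * v) (p1 * p3 + p2 * p4 * t1 + p4 * u)).
  by rewrite /rel1 /rel2 /rel3 /rel4 /rel6; ring.
have r7 : rel7 = 0.
  apply: (cancel_Dl _
    (p4 * s2 - p1 * p2 * L135 - (p1 * p4 + p2 * p3) * L136 - p3 * p4 * L245)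
    (- p2 * s2 - p1 * p2 * L136 - (p1 * p4 + p2 * p3) * L245 - p3 * p4 * L246)
    (p2 ^+ 2 * L135 + 2 * p2 * p4 * L136 + p4 ^+ 2 * L245 - p4 * s1)
    (p2 ^+ 2 * L136 + 2 * p2 * p4 * L245 + p4 ^+ 2 * L246 + p2 * s1)).
  by rewrite /rel1 /rel2 /rel3 /rel4 /rel7; ring.
have r8 : rel8 = 0.
  apply: (cancel_Dl _
    (Dl * L125 + p2 ^+ 2 * t1 * L135 + 2 * p2 * p4 * t1 * L136 + p2 * u * L135
     + p2 * v * L136 + p4 ^+ 2 * t1 * L245 + p4 * u * L136 + p4 * v * L245
     - p4 * s3 + v * s1)
    (Dl * L126 + p2 ^+ 2 * t1 * L136 + 2 * p2 * p4 * t1 * L245 + p2 * u * L136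
     + p2 * v * L245 + p2 * s3 + p4 ^+ 2 * t1 * L246 + p4 * u * L245
     + p4 * v * L246 - u * s1)
    (p1 * p2 * L135 + (p1 * p4 + p2 * p3) * L136 + p3 * p4 * L245 - p3 * s1)
    (p1 * p2 * L136 + p1 * s1 + (p1 * p4 + p2 * p3) * L245 + p3 * p4 * L246)).
  by rewrite /rel1 /rel2 /rel3 /rel4 /rel8; ring.
have r9 : rel9 = 0.
  apply: (cancel_Dl _
    (Dl * L123 + p2 ^+ 2 * t2 * L135 + 2 * p2 * p4 * t2 * L136
     + p4 ^+ 2 * t2 * L245 + v * s2)
    (Dl * L124 + p2 ^+ 2 * t2 * L136 + 2 * p2 * p4 * t2 * L245
     + p4 ^+ 2 * t2 * L246 - u * s2)
    (p2 * u * L135 + p2 * v * L136 - p3 * s2 + p4 * u * L136 + p4 * v * L245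
     - p4 * s3)
    (p1 * s2 + p2 * u * L136 + p2 * v * L245 + p2 * s3 + p4 * u * L245
     + p4 * v * L246)).
  by rewrite /rel1 /rel2 /rel3 /rel4 /rel9; ring.
by do 9?[case=> [|]]; rewrite //= => k; rewrite nth_nil.
Qed.

End PlueckerChart.

(* The binary cubic form with coefficients [L135], [L136], [L245], [L246]
   at [(p2, p4)]; [qf] is a third of its derivative in [p4]. *)
Definition cubic_form :=
  L135 * p2 ^+ 3 + 3 * L136 * p2 ^+ 2 * p4 + 3 * L245 * p2 * p4 ^+ 2
  + L246 * p4 ^+ 3.
Local Notation f := cubic_form.
Local Notation qf := (L136 * p2 ^+ 2 + 2 * L245 * p2 * p4 + L246 * p4 ^+ 2).
Local Notation w := (p2 * v - p4 * u).

(** The combination kills s3 and leaves s2 with coefficient [Delta]. Modulo [Delta], and with w = p2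
    v - p4 u as a coordinate, it determines [u1] and hence u, after division by the cubic form and
    p2. *)
Lemma rel12_eq : p2 ^+ 2 * (p2 * rel2 - p4 * rel1) =
  f * u1 + p2 * w * (p2 * s1 + qf) + Dl * (p2 ^+ 2 * s2
    + p2 ^+ 2 * (p2 * L125 + p4 * L126)
    - (p2 * (p2 * L136 + p4 * L245) * 2 * p1
       + (p2 * L245 + p4 * L246) * (p2 * p3 + p1 * p4))).
Proof. rewrite /rel1 /rel2 /cubic_form; ring. Qed.

(** Here s1 cancels and s3 gets the coefficient [Delta]; modulo [Delta] the identity determines
    [i1], hence t2. *)
Lemma rel34_eq : p2 ^+ 2 * (p2 * rel4 - p4 * rel3) =
  f * i1 + w * (p2 ^+ 2 * s2 + p1 * qf) + Dl * (p2 ^+ 2 * s3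
    + p2 ^+ 2 * (p2 * L123 + p4 * L124)
    - p2 * (u * (p2 * L136 + p4 * L245) + v * (p2 * L245 + p4 * L246))).
Proof. rewrite /rel3 /rel4 /cubic_form; ring. Qed.

(** Modulo [Delta] the right-hand side is a 2 x 2 determinant, and the values of [f * u1] and
    [f * i1] given by the two previous identities make its rows proportional. So [rel3] is no new
    condition on the divisor. *)
Lemma rel13_eq : p2 ^+ 2 * (p2 * rel3 - p1 * rel1) =
  u1 * (p2 ^+ 2 * s2 + p1 * qf) - p2 * i1 * (p2 * s1 + qf)
  + Dl * (p1 * p2 ^+ 2 * L126 - p2 ^+ 3 * L124 - 2 * p1 ^+ 2 * p2 * L245
    - p1 * (p1 * p4 + p2 * p3) * L246 + p2 ^+ 2 * (u * L245 + v * L246)).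
Proof. rewrite /rel1 /rel3; ring. Qed.

(** With p2 L123 + p4 L124 as a coordinate, [rel7] becomes affine in L124 with leading coefficient
    [- f]. *)
Lemma rel7_eq : p2 * rel7 =
  (p2 * s1 + qf) * (p2 * L123 + p4 * L124) - f * L124
  + p2 * (- s2 ^+ 2 + s1 * s3 - (L125 * p2 + L126 * p4) * s2
    - L125 * la (p1 * p2) (p2 * p3 + p1 * p4) (p3 * p4)
    + L126 * mu (p1 * p2) (p2 * p3 + p1 * p4) (p3 * p4)
    + k1 * (- p1 ^+ 2 + 2 * u * p2 + t1 * p2 ^+ 2)
    + k2 * (- p1 * p3 + u * p4 + v * p2 + t1 * p2 * p4)
    + k3 * (- p3 ^+ 2 + 2 * v * p4 + t1 * p4 ^+ 2)).
Proof. rewrite /rel7 /cubic_form; ring. Qed.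

Section DeltaChart.

Hypotheses (domA : is_domain A) (Dl0 : Dl = 0) (p20 : p2 <> 0) (f0 : f <> 0).
Hypotheses (r1 : rel1 = 0) (r7 : rel7 = 0).
Hypothesis u1E : f * u1 = - (p2 * w * (p2 * s1 + qf)).
Hypothesis i1E : f * i1 = - (w * (p2 ^+ 2 * s2 + p1 * qf)).

(** The hypotheses [r1], [r7], [u1E], [i1E] are the equations that define s3, L124, u and t2 by
    division by p2 and [f]; the remaining relations follow by syzygies, after cancelling these two
    factors. *)
Lemma Pi_point_of_Delta0 : Pi_point.
Proof.
have cancel_p2 b : p2 * b = 0 -> b = 0 by move/domA => [].
have cancel_p22 b : p2 ^+ 2 * b = 0 -> b = 0.
  by rewrite expr2 -mulrA => /cancel_p2/cancel_p2.
have cancel_f b : f * b = 0 -> b = 0 by move/domA => [].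
have r2 : rel2 = 0.
  apply/cancel_p2/cancel_p22.
  have := rel12_eq; rewrite r1 Dl0 mulr0 subr0 => ->.
  by rewrite u1E; ring.
have r3 : rel3 = 0.
  apply/cancel_p2/cancel_p22/cancel_f.
  have := rel13_eq; rewrite r1 Dl0 mulr0 subr0 => ->.
  set a := p2 ^+ 2 * s2 + p1 * qf; set b := p2 * s1 + qf.
  transitivity (f * u1 * a - p2 * (f * i1) * b); first by ring.
  by rewrite u1E i1E -/a -/b; ring.
have r4 : rel4 = 0.
  apply/cancel_p2/cancel_p22.
  have := rel34_eq; rewrite r3 Dl0 mulr0 subr0 => ->.
  by rewrite i1E; ring.
have r5 : rel5 = 0.
  apply: cancel_f.
  transitivity
   ((- p2 ^+ 2 * p4 * L123 + p2 ^+ 2 * v * L136 - p2 * p4 ^+ 2 * L124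
       + 2 * p2 * p4 * v * L245 - p2 * p4 * s3 + p4 ^+ 2 * v * L246) * rel1
    + (p2 ^+ 3 * L123 + p2 ^+ 2 * p4 * L124 - p2 ^+ 2 * u * L136
       + p2 ^+ 2 * s3 - 2 * p2 * p4 * u * L245 - p4 ^+ 2 * u * L246) * rel2
    + (p1 * p2 ^+ 2 * L135 + p1 * p2 * p4 * L136 + p2 ^+ 2 * p4 * L125
       - p2 * p3 * p4 * L245 + p2 * p4 ^+ 2 * L126 + p2 * p4 * s2
       - p3 * p4 ^+ 2 * L246) * rel3
    + (2 * p1 * p2 ^+ 2 * L136 + 3 * p1 * p2 * p4 * L245
       + p1 * p4 ^+ 2 * L246 - p2 ^+ 3 * L125 + p2 ^+ 2 * p3 * L245
       - p2 ^+ 2 * p4 * L126 - p2 ^+ 2 * s2 + p2 * p3 * p4 * L246) * rel4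
    + (p2 * p4 * u - p2 ^+ 2 * v) * rel7).
    by rewrite /rel1 /rel2 /rel3 /rel4 /rel5 /rel7 /cubic_form; ring.
  by rewrite r1 r2 r3 r4 r7; ring.
have r6 : rel6 = 0.
  apply: cancel_p2.
  transitivity (- v * rel1 + u * rel2 + p3 * rel3 - p1 * rel4 + p4 * rel5).
    by rewrite /rel1 /rel2 /rel3 /rel4 /rel5 /rel6; ring.
  by rewrite r1 r2 r3 r4 r5; ring.
have r8 : rel8 = 0.
  apply: cancel_p2.
  transitivity ((p1 * L136 + p3 * L245 - s2) * rel1
    + (p1 * L245 + p3 * L246) * rel2 + (s1 - p2 * L136 - p4 * L245) * rel3
    - (p2 * L245 + p4 * L246) * rel4 + p1 * rel7).
    by rewrite /rel1 /rel2 /rel3 /rel4 /rel7 /rel8; ring.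
  by rewrite r1 r2 r3 r4 r7; ring.
have r9 : rel9 = 0.
  apply: cancel_p2.
  transitivity ((- p4 * L124 + v * L245 - s3) * rel1
    + (p2 * L124 - u * L245) * rel2 + (p1 * L136 + p4 * L126 + s2) * rel3
    + (2 * p1 * L245 - p2 * L126 + p3 * L246) * rel4
    - (p2 * L136 + 2 * p4 * L245) * rel5 - p4 * L246 * rel6 + u * rel7).
    by rewrite /rel1 /rel2 /rel3 /rel4 /rel5 /rel6 /rel7 /rel9; ring.
  by rewrite r1 r2 r3 r4 r5 r6 r7; ring.
by do 9?[case=> [|]]; rewrite //= => k; rewrite nth_nil.
Qed.

End DeltaChart.

End Relations.

Lemma Pi_gensE (K : comNzRingType) i : Pi_gens K i = (rels (Pi_var K))`_i.
Proof. by []. Qed.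

Lemma rels_morph (A B : comNzRingType) (g : {rmorphism A -> B}) x :
  map g (rels x) = rels (g \o x).
Proof.
have gD a a' b b' : g a = a' -> g b = b' -> g (a + b) = a' + b'.
  by move=> <- <-; rewrite rmorphD.
have gN a a' : g a = a' -> g (- a) = - a' by move=> <-; rewrite rmorphN.
have gM a a' b b' : g a = a' -> g b = b' -> g (a * b) = a' * b'.
  by move=> <- <-; rewrite rmorphM.
have gX a a' n : g a = a' -> g (a ^+ n) = a' ^+ n by move=> <-; rewrite rmorphXn.
have gn n : g n%:R = n%:R by rewrite rmorph_nat.
rewrite /rels; congr [:: _; _; _; _; _; _; _; _; _].
all: rewrite /rel1 /rel2 /rel3 /rel4 /rel5 /rel6 /rel7 /rel8 /rel9 /=.
all: repeat lazymatch goal with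
  | |- _ (_ + _) = _ => apply gD
  | |- _ (- _) = _ => apply gN
  | |- _ (_ * _) = _ => apply gM
  | |- _ (_ ^+ _) = _ => apply gX
  | |- _ (_ %:R) = _ => apply gn
  | |- _ => reflexivity
  end.
Qed.

Lemma rels_ext (A : comNzRingType) (x y : nat -> A) :
  (forall k, (k < 19)%N -> x k = y k) -> rels x = rels y.
Proof.
move=> xy; rewrite /rels /rel1 /rel2 /rel3 /rel4 /rel5 /rel6 /rel7 /rel8 /rel9.
by rewrite !xy.
Qed.

(** * A finite set of generators *)

(* Fifteen elements over whose polynomial ring the coordinate ring is free,
   with basis [Pi_basis]. *)
Definition Pi_par (A : comNzRingType) (x : nat -> A) : seq A :=
  [:: x 0%N; x 1%N; x 3%N; x 6%N; x 7%N; x 12%N; x 13%N; x 14%N;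
      x 15%N - x 5%N; x 16%N - x 4%N; x 8%N; x 9%N; x 10%N; x 11%N; x 2%N].

Definition Pi_basis (A : comNzRingType) (x : nat -> A) : seq A :=
  [:: 1; x 4%N; x 5%N; x 17%N; x 18%N; x 5%N ^+ 2; x 5%N ^+ 3].

(* The relations are homogeneous for these weights of the parameters. *)
Definition par_weight : seq nat :=
  [:: 4; 3; 2; 2; 3; 1; 2; 3; 4; 5; 4; 5; 3; 4; 3]%N.

Section Span.

Variables (K A : comNzRingType) (kappa : {rmorphism K -> A}) (x : nat -> A).
Hypothesis xP : Pi_point x.

Local Notation p1 := (x 0%N).
Local Notation p2 := (x 1%N).
Local Notation p3 := (x 2%N).
Local Notation p4 := (x 3%N).
Local Notation u := (x 4%N).
Local Notation v := (x 5%N).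
Local Notation t1 := (x 6%N).
Local Notation t2 := (x 7%N).
Local Notation L123 := (x 8%N).
Local Notation L124 := (x 9%N).
Local Notation L125 := (x 10%N).
Local Notation L126 := (x 11%N).
Local Notation L135 := (x 12%N).
Local Notation L136 := (x 13%N).
Local Notation L245 := (x 14%N).
Local Notation L246 := (x 15%N).
Local Notation s1 := (x 16%N).
Local Notation s2 := (x 17%N).
Local Notation s3 := (x 18%N).
Local Notation par := (Pi_par x).
Local Notation wt i := (nth 0%N par_weight i).

Definition par_eval : {mpoly K[15]} -> A := mmap kappa (fun i => par`_i).

HB.instance Definition _ := GRing.RMorphism.on par_eval.

Definition spanned (r : A) :=
  exists c : 'I_7 -> {mpoly K[15]}, r = \sum_i par_eval (c i) * (Pi_basis x)`_i.

Lemma spanned0 : spanned 0.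
Proof. by exists (fun=> 0); rewrite big1 // => i _; rewrite rmorph0 mul0r. Qed.

Lemma spannedD a b : spanned a -> spanned b -> spanned (a + b).
Proof.
move=> [c ->] [d ->]; exists (fun i => c i + d i); rewrite -big_split /=.
by apply: eq_bigr => i _; rewrite rmorphD mulrDl.
Qed.

Lemma spanned_par_eval p a : spanned a -> spanned (par_eval p * a).
Proof.
move=> [c ->]; exists (fun i => p * c i); rewrite mulr_sumr.
by apply: eq_bigr => i _; rewrite rmorphM mulrA.
Qed.

Lemma spannedN a : spanned a -> spanned (- a).
Proof. by move/(spanned_par_eval (- 1)); rewrite rmorphN rmorph1 mulN1r. Qed.

Lemma spanned_basis i : (i < 7)%N -> spanned (Pi_basis x)`_i.
Proof.
move=> lt_i; exists (fun j => if j == Ordinal lt_i then 1 else 0).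
rewrite (bigD1 (Ordinal lt_i)) //= eqxx rmorph1 mul1r big1 ?addr0 // => j /negPf->.
by rewrite rmorph0 mul0r.
Qed.

Lemma par_eval_X i : (i < 15)%N -> exists p, par`_i = par_eval p.
Proof.
by move=> lt_i; exists 'X_(Ordinal lt_i); rewrite /par_eval mmapX mmap1U.
Qed.

Lemma par_eval_C c : kappa c = par_eval c%:MP.
Proof. by rewrite /par_eval mmapC. Qed.

Definition fib : seq A := [:: u; v; s2; s3].
Definition fib_weight : seq nat := [:: 5; 4; 6; 7]%N.
Local Notation fw i := (nth 0%N fib_weight i).

(** [A] carries no grading, so weights belong to expressions and bound them from above: [filt]
    bounds combinations of monomials, [small] bounds such combinations inside the ideal of the
    parameters. *)
Inductive wmon : nat -> A -> Prop :=
| wmon1 : wmon 0 1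
| wmon_par i n a : (i < 15)%N -> wmon n a -> wmon (wt i + n) (par`_i * a)
| wmon_fib i n a : (i < 4)%N -> wmon n a -> wmon (fw i + n) (fib`_i * a).

Inductive filt : nat -> A -> Prop :=
| filt0 n : filt n 0
| filtD0 n a b : filt n a -> filt n b -> filt n (a + b)
| filt_mon m n a c : (m <= n)%N -> wmon m a -> filt n (kappa c * a).

Inductive small : nat -> A -> Prop :=
| small0 n : small n 0
| smallD0 n a b : small n a -> small n b -> small n (a + b)
| small_par0 i m n a :
    (i < 15)%N -> (wt i + m <= n)%N -> filt m a -> small n (par`_i * a).

Lemma wmonM m n a b : wmon m a -> wmon n b -> wmon (m + n) (a * b).
Proof.
move=> ma nb; elim: ma => [|i k c lt_i _ IH|i k c lt_i _ IH].
- by rewrite mul1r.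
- by rewrite -mulrA -addnA; apply: wmon_par.
- by rewrite -mulrA -addnA; apply: wmon_fib.
Qed.

Lemma filt_le m n a : (m <= n)%N -> filt m a -> filt n a.
Proof.
move=> le_mn ma; elim: ma n le_mn => {m a} [m|m a b _ IHa _ IHb|k m a c le_km ka] n le_mn.
- exact: filt0.
- by apply: filtD0; [apply: IHa|apply: IHb].
- by apply: (filt_mon _ _ ka); apply: leq_trans le_mn.
Qed.

Lemma filtM m n a b : filt m a -> filt n b -> filt (m + n) (a * b).
Proof.
elim=> {m a} [m|m a a' _ IHa _ IHa'|k m a c le_km ka] nb.
- by rewrite mul0r; apply: filt0.
- by rewrite mulrDl; apply: filtD0; [apply: IHa|apply: IHa'].
elim: nb => {n b} [n|n b b' _ IHb _ IHb'|l n b d le_ln lb].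
- by rewrite mulr0; apply: filt0.
- by rewrite mulrDr; apply: filtD0.
- by rewrite mulrACA -rmorphM; apply: filt_mon (wmonM ka lb); apply: leq_add.
Qed.

Lemma filtC c : filt 0 (kappa c).
Proof. by rewrite -[kappa c]mulr1; apply: filt_mon wmon1. Qed.

Lemma filt_nat n : filt 0 n%:R.
Proof. by rewrite -(rmorph_nat kappa); apply: filtC. Qed.

Lemma filt1 : filt 0 1.
Proof. exact: (filt_nat 1). Qed.

Lemma filtN n a : filt n a -> filt n (- a).
Proof.
by move/(filtM (filtC (- 1))); rewrite rmorphN rmorph1 mulN1r.
Qed.

Lemma filtD m n a b : filt m a -> filt n b -> filt (maxn m n) (a + b).
Proof.
move=> ma nb; apply: filtD0; first exact: filt_le (leq_maxl _ _) ma.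
exact: filt_le (leq_maxr _ _) nb.
Qed.

Lemma filt_sqr m a : filt m a -> filt (m + m) (a ^+ 2).
Proof. by move=> ma; rewrite expr2; apply: filtM. Qed.

Lemma filtX m a k : filt m a -> filt (k * m) (a ^+ k).
Proof.
move=> ma; elim: k => [|k IH]; first exact: filt1.
by rewrite exprS mulSn; apply: filtM.
Qed.

Lemma filt_wmon n a : wmon n a -> filt n a.
Proof.
by move=> na; rewrite -[a]mul1r -(rmorph1 kappa); apply: filt_mon na.
Qed.

Lemma filt_par i : (i < 15)%N -> filt (wt i) par`_i.
Proof.
move=> lt_i; rewrite -[par`_i]mulr1 -[wt i]addn0.
exact/filt_wmon/wmon_par/wmon1.
Qed.

Lemma filt_fib i : (i < 4)%N -> filt (fw i) fib`_i.
Proof.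
move=> lt_i; rewrite -[fib`_i]mulr1 -[fw i]addn0.
exact/filt_wmon/wmon_fib/wmon1.
Qed.

Lemma small_le m n a : (m <= n)%N -> small m a -> small n a.
Proof.
move=> le_mn ma; elim: ma n le_mn => {m a} [m|m a b _ IHa _ IHb|i k m a lt_i le_m ka] n le_mn.
- exact: small0.
- by apply: smallD0; [apply: IHa|apply: IHb].
- by apply: small_par0 ka => //; apply: leq_trans le_mn.
Qed.

Lemma smallMl m n a b : small m a -> filt n b -> small (m + n) (a * b).
Proof.
move=> ma nb; elim: ma => {m a} [m|m a a' _ IHa _ IHa'|i k m a lt_i le_m ka].
- by rewrite mul0r; apply: small0.
- by rewrite mulrDl; apply: smallD0; [apply: IHa|apply: IHa'].
rewrite -mulrA; apply: (small_par0 (m := k + n)) => //; last exact: filtM.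
by rewrite addnA leq_add2r.
Qed.

Lemma smallMr m n a b : filt m a -> small n b -> small (m + n) (a * b).
Proof. by move=> ma nb; rewrite mulrC addnC; apply: smallMl. Qed.

Lemma smallN n a : small n a -> small n (- a).
Proof. by move/(smallMr (filtC (- 1))); rewrite rmorphN rmorph1 mulN1r. Qed.

Lemma smallD m n a b : small m a -> small n b -> small (maxn m n) (a + b).
Proof.
move=> ma nb; apply: smallD0; first exact: small_le (leq_maxl _ _) ma.
exact: small_le (leq_maxr _ _) nb.
Qed.

Lemma small_sqr m a : small m a -> filt m a -> small (m + m) (a ^+ 2).
Proof. by move=> ma fa; rewrite expr2; apply: smallMl. Qed.

Lemma small_par i : (i < 15)%N -> small (wt i) par`_i.
Proof.
move=> lt_i; rewrite -[par`_i]mulr1; apply: small_par0 filt1 => //.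
by rewrite addn0.
Qed.

Lemma filt_s1 : filt 5 s1.
Proof.
have -> : s1 = par`_9 + fib`_0 by rewrite /= subrK.
exact: (filtD (filt_par (i := 9) _) (filt_fib (i := 0) _)).
Qed.

Lemma filt_L246 : filt 4 L246.
Proof.
have -> : L246 = par`_8 + fib`_1 by rewrite /= subrK.
exact: (filtD (filt_par (i := 8) _) (filt_fib (i := 1) _)).
Qed.

Ltac par_index a k := lazymatch a with
  | p1 => k constr:(0%N) | p2 => k constr:(1%N) | p4 => k constr:(2%N)
  | t1 => k constr:(3%N) | t2 => k constr:(4%N) | L135 => k constr:(5%N)
  | L136 => k constr:(6%N) | L245 => k constr:(7%N)
  | L246 - v => k constr:(8%N) | s1 - u => k constr:(9%N)
  | L123 => k constr:(10%N) | L124 => k constr:(11%N)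
  | L125 => k constr:(12%N) | L126 => k constr:(13%N) | p3 => k constr:(14%N)
  end.

Ltac solve_filt := lazymatch goal with
  | |- filt _ u => exact: (filt_fib (i := 0))
  | |- filt _ v => exact: (filt_fib (i := 1))
  | |- filt _ s2 => exact: (filt_fib (i := 2))
  | |- filt _ s3 => exact: (filt_fib (i := 3))
  | |- filt _ s1 => exact: filt_s1
  | |- filt _ L246 => exact: filt_L246
  | |- filt _ (_ %:R) => exact: filt_nat
  | |- filt _ ?a => first
    [ par_index a ltac:(fun k => exact: (filt_par (i := k)))
    | lazymatch a with
      | _ + _ => eapply filtD; solve_filt
      | - _ => eapply filtN; solve_filt
      | _ * _ => eapply filtM; solve_filt
      | _ ^+ 2 => eapply filt_sqr; solve_filt
      end ]
  end.

Ltac solve_small := lazymatch goal with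
  | |- small _ ?a => first
    [ par_index a ltac:(fun k => exact: (small_par (i := k)))
    | lazymatch a with
      | _ + _ => eapply smallD; solve_small
      | - _ => eapply smallN; solve_small
      | _ * _ => first [ eapply smallMl; [solve_small | solve_filt]
                       | eapply smallMr; [solve_filt | solve_small] ]
      | _ ^+ 2 => eapply small_sqr; [solve_small | solve_filt]
      end ]
  end.

Local Notation Dl := (p1 * p4 - p2 * p3).
Local Notation la X Y Z := (L136 * X + L245 * Y + L246 * Z).
Local Notation mu X Y Z := (L135 * X + L136 * Y + L245 * Z).
Local Notation u1 := (p1 ^+ 2 + t1 * p2 ^+ 2 + p2 * u).
Local Notation u2 := (2 * p1 * p3 + 2 * t1 * p2 * p4 + p4 * u + p2 * v).
Local Notation u3 := (p3 ^+ 2 + t1 * p4 ^+ 2 + p4 * v).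
Local Notation i1 := (t2 * p2 ^+ 2 + p1 * u).
Local Notation i2 := (2 * t2 * p2 * p4 + p3 * u + p1 * v).
Local Notation i3 := (t2 * p4 ^+ 2 + p3 * v).
Local Notation w1 := (t1 * p2 * u - t2 * p1 * p2 + u ^+ 2).
Local Notation w2 :=
  (t1 * (p4 * u + p2 * v) - t2 * (p2 * p3 + p1 * p4) + 2 * u * v).
Local Notation w3 := (t1 * p4 * v - t2 * p3 * p4 + v ^+ 2).
Local Notation k1 := (L135 * L245 - L136 ^+ 2).
Local Notation k2 := (L135 * L246 - L136 * L245).
Local Notation k3 := (L136 * L246 - L245 ^+ 2).

Ltac prove_small := eapply small_le; last solve_small; by [].

(** This and the next eight lemmas are the multiplication table of the fibre over the origin, each
    relation solved for one product of two of u, v, s2, s3; only v ^ 2 is missing. The bounds are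
    the weights of the products. *)
Lemma small_uu : small 10 (u ^+ 2).
Proof.
have -> : u ^+ 2 = p1 * s2 + p2 * s3 + L126 * Dl + la u1 u2 u3 - u * (s1 - u).
  by apply: subr0_eq; rewrite -[RHS](xP 0) /= /rel1; ring.
prove_small.
Qed.

Lemma small_uv : small 9 (u * v).
Proof.
have -> : u * v = p3 * s2 + p4 * s3 - L125 * Dl - mu u1 u2 u3 - v * (s1 - u).
  by apply: subr0_eq; rewrite -[RHS](xP 1) /= /rel2; ring.
prove_small.
Qed.

Lemma small_us2 : small 11 (u * s2).
Proof.
have -> : u * s2 = t2 * p2 * s1 - t1 * p2 * s2 + p1 * s3 + L124 * Dl + la i1 i2 i3.
  by apply: subr0_eq; rewrite -[RHS](xP 2) /= /rel3; ring.
prove_small.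
Qed.

Lemma small_vs2 : small 10 (v * s2).
Proof.
have -> : v * s2 = t2 * p4 * s1 - t1 * p4 * s2 + p3 * s3 - L123 * Dl - mu i1 i2 i3.
  by apply: subr0_eq; rewrite -[RHS](xP 3) /= /rel4; ring.
prove_small.
Qed.

Lemma small_us3 : small 12 (u * s3 - v ^+ 3).
Proof.
have -> : u * s3 - v ^+ 3 =
    t2 * p1 * s1 - (t1 * p1 - t2 * p2) * s2 - t1 * p2 * s3 - L123 * u1
    - L124 * (p1 * p3 + t1 * p2 * p4 + p2 * v) + L125 * i1
    + L126 * (t2 * p2 * p4 + p1 * v) + L136 * w1 + L245 * w2
    + v * (t1 * p4 * v - t2 * p3 * p4) + (L246 - v) * w3.
  by apply: subr0_eq; rewrite -[RHS](xP 4) /= /rel5; ring.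
prove_small.
Qed.

Lemma small_vs3 : small 11 (v * s3).
Proof.
have -> : v * s3 =
    t2 * p3 * s1 - (t1 * p3 - t2 * p4) * s2 - t1 * p4 * s3
    - L123 * (p1 * p3 + t1 * p2 * p4 + p4 * u) - L124 * u3
    + L125 * (t2 * p2 * p4 + p3 * u) + L126 * i3 - mu w1 w2 w3.
  by apply: subr0_eq; rewrite -[RHS](xP 5) /= /rel6; ring.
prove_small.
Qed.

Lemma small_s2s2 : small 12 (s2 ^+ 2 - u * s3).
Proof.
have -> : s2 ^+ 2 - u * s3 =
    (s1 - u) * s3 + (L123 * p2 + L124 * p4) * s1 - (L125 * p2 + L126 * p4) * s2
    + L123 * la (p2 ^+ 2) (2 * p2 * p4) (p4 ^+ 2)
    - L124 * mu (p2 ^+ 2) (2 * p2 * p4) (p4 ^+ 2)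
    - L125 * la (p1 * p2) (p2 * p3 + p1 * p4) (p3 * p4)
    + L126 * mu (p1 * p2) (p2 * p3 + p1 * p4) (p3 * p4)
    + k1 * (- p1 ^+ 2 + 2 * u * p2 + t1 * p2 ^+ 2)
    + k2 * (- p1 * p3 + u * p4 + v * p2 + t1 * p2 * p4)
    + k3 * (- p3 ^+ 2 + 2 * v * p4 + t1 * p4 ^+ 2).
  apply: subr0_eq; rewrite -oppr0 -[in RHS](xP 6) /= /rel7; ring.
prove_small.
Qed.

Lemma small_s2s3 : small 13 (s2 * s3).
Proof.
have -> : s2 * s3 = - (t1 * s1 * s2 - t2 * s1 ^+ 2
  + s1 * (L123 * p1 + L124 * p3) - s2 * (L125 * p1 + L126 * p3)
  + L123 * la (p1 * p2) (p1 * p4 + p2 * p3) (p3 * p4)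
  - L124 * mu (p1 * p2) (p1 * p4 + p2 * p3) (p3 * p4)
  - L125 * la (p1 ^+ 2) (2 * p1 * p3) (p3 ^+ 2)
  + L126 * mu (p1 ^+ 2) (2 * p1 * p3) (p3 ^+ 2)
  + k1 * (2 * u * p1 + 2 * t1 * p1 * p2 - t2 * p2 ^+ 2)
  + k2 * (v * p1 + u * p3 + t1 * (p1 * p4 + p2 * p3) - t2 * p2 * p4)
  + k3 * (2 * v * p3 + 2 * t1 * p3 * p4 - t2 * p4 ^+ 2)).
  by apply: subr0_eq; rewrite -[RHS](xP 7) /= /rel8; ring.
prove_small.
Qed.

Lemma small_s3s3 : small 14 (s3 ^+ 2).
Proof.
have -> : s3 ^+ 2 = - (t1 * s2 ^+ 2 - t2 * s1 * s2
  + s1 * (L123 * u + L124 * v) - s2 * (L125 * u + L126 * v)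
  + (L124 * L125 - L123 * L126) * Dl
  - L123 * la (p1 ^+ 2 + t1 * p2 ^+ 2) (2 * p1 * p3 + 2 * t1 * p2 * p4)
              (p3 ^+ 2 + t1 * p4 ^+ 2)
  + L124 * mu (p1 ^+ 2 + t1 * p2 ^+ 2) (2 * p1 * p3 + 2 * t1 * p2 * p4)
              (p3 ^+ 2 + t1 * p4 ^+ 2)
  + t2 * L125 * la (p2 ^+ 2) (2 * p2 * p4) (p4 ^+ 2)
  - t2 * L126 * mu (p2 ^+ 2) (2 * p2 * p4) (p4 ^+ 2)
  + k1 * (u ^+ 2 + 2 * t2 * p1 * p2)
  + k2 * (u * v + t2 * (p2 * p3 + p1 * p4))
  + k3 * (v ^+ 2 + 2 * t2 * p3 * p4)).
  by apply: subr0_eq; rewrite -[RHS](xP 8) /= /rel9; ring.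
prove_small.
Qed.

Lemma wmon_small_or_fib n a : wmon n a -> small n a \/
  exists b c d e, n = (5 * b + 4 * c + 6 * d + 7 * e)%N /\
    a = u ^+ b * v ^+ c * s2 ^+ d * s3 ^+ e.
Proof.
elim=> {n a} [|i n a lt_i na _|i n a lt_i na [na'|]].
- by right; exists 0%N, 0%N, 0%N, 0%N; split; rewrite // !expr0 !mulr1.
- by left; apply: (smallMl (small_par lt_i) (filt_wmon na)).
- by left; apply: (smallMr (filt_fib lt_i) na').
move=> [b [c [d [e [-> ->]]]]]; right.
case: i lt_i => [|[|[|[|//]]]] _ /=.
- by exists b.+1, c, d, e; split; [lia|rewrite exprS; ring].
- by exists b, c.+1, d, e; split; [lia|rewrite exprS; ring].
- by exists b, c, d.+1, e; split; [lia|rewrite exprS; ring].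
- by exists b, c, d, e.+1; split; [lia|rewrite exprS; ring].
Qed.

Lemma spanned_filt n a : (forall m b, (m <= n)%N -> wmon m b -> spanned b) ->
  filt n a -> spanned a.
Proof.
move=> + na; elim: na => {n a} [n _|n a b _ IHa _ IHb nP|m n a c le_mn ma nP].
- exact: spanned0.
- by apply: spannedD; [apply: IHa|apply: IHb].
by rewrite par_eval_C; apply/spanned_par_eval/nP/ma.
Qed.

Lemma spanned_small n a : (forall m b, (m < n)%N -> filt m b -> spanned b) ->
  small n a -> spanned a.
Proof.
move=> + na; elim: na => {n a} [n _|n a b _ IHa _ IHb nP|i m n a lt_i le_mn ma nP].
- exact: spanned0.
- by apply: spannedD; [apply: IHa|apply: IHb].
have [p ->] := par_eval_X lt_i; apply/spanned_par_eval/nP/ma.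
(* All parameters have positive weight, so removing one lowers the bound strictly. *)
apply: leq_trans le_mn; rewrite -{1}[m]add0n ltn_add2r.
have /allP/(_ i) : all (fun i => 0 < wt i)%N (iota 0 15) by [].
by rewrite mem_iota; apply.
Qed.

(** A monomial outside the basis contains an entry of the multiplication table; the entry replaces
    it by smaller weights times parameters, plus possibly v ^ 3. *)
Lemma spanned_fib n b c d e :
  (forall m a, (m < n)%N -> filt m a -> spanned a) ->
  n = (5 * b + 4 * c + 6 * d + 7 * e)%N ->
  spanned (u ^+ b * v ^+ c * s2 ^+ d * s3 ^+ e).
Proof.
move=> IH nE.
have sm m k y z : (m + k)%N = n -> small m y -> filt k z -> spanned (y * z).
  by move=> mk my kz; apply: (spanned_small IH); rewrite -mk; apply: smallMl.
have fu := filt_fib (i := 0) isT; have fv := filt_fib (i := 1) isT.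
have fs2 := filt_fib (i := 2) isT; have fs3 := filt_fib (i := 3) isT.
have ff b' c' d' e' :
    filt (b' * 5 + c' * 4 + d' * 6 + e' * 7) (u ^+ b' * v ^+ c' * s2 ^+ d' * s3 ^+ e').
  exact: filtM (filtM (filtM (filtX _ fu) (filtX _ fv)) (filtX _ fs2)) (filtX _ fs3).
case: b nE => [|[|b]] nE; last first.
  have -> : u ^+ b.+2 * v ^+ c * s2 ^+ d * s3 ^+ e =
      u ^+ 2 * (u ^+ b * v ^+ c * s2 ^+ d * s3 ^+ e) by rewrite !exprS; ring.
  by apply: sm small_uu (ff _ _ _ _); lia.
- case: c nE => [|c] nE; last first.
    have -> : u ^+ 1 * v ^+ c.+1 * s2 ^+ d * s3 ^+ e =
        u * v * (u ^+ 0 * v ^+ c * s2 ^+ d * s3 ^+ e) by rewrite !exprS; ring.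
    by apply: sm small_uv (ff _ _ _ _); lia.
  case: d nE => [|d] nE; last first.
    have -> : u ^+ 1 * v ^+ 0 * s2 ^+ d.+1 * s3 ^+ e =
        u * s2 * (u ^+ 0 * v ^+ 0 * s2 ^+ d * s3 ^+ e) by rewrite !exprS; ring.
    by apply: sm small_us2 (ff _ _ _ _); lia.
  case: e nE => [|[|e]] nE; last first.
  + have -> : u ^+ 1 * v ^+ 0 * s2 ^+ 0 * s3 ^+ e.+2 =
        s3 ^+ 2 * (u ^+ 1 * v ^+ 0 * s2 ^+ 0 * s3 ^+ e) by rewrite !exprS; ring.
    by apply: sm small_s3s3 (ff _ _ _ _); lia.
  + have -> : u ^+ 1 * v ^+ 0 * s2 ^+ 0 * s3 ^+ 1 = (u * s3 - v ^+ 3) * 1 + v ^+ 3 by ring.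
    apply: spannedD; last exact: (spanned_basis (i := 6)).
    by apply: sm small_us3 filt1; lia.
  + have -> : u ^+ 1 * v ^+ 0 * s2 ^+ 0 * s3 ^+ 0 = u by ring.
    exact: (spanned_basis (i := 1)).
case: c nE => [|c] nE; last first.
  case: d nE => [|d] nE; last first.
    have -> : u ^+ 0 * v ^+ c.+1 * s2 ^+ d.+1 * s3 ^+ e =
        v * s2 * (u ^+ 0 * v ^+ c * s2 ^+ d * s3 ^+ e) by rewrite !exprS; ring.
    by apply: sm small_vs2 (ff _ _ _ _); lia.
  case: e nE => [|e] nE; last first.
    have -> : u ^+ 0 * v ^+ c.+1 * s2 ^+ 0 * s3 ^+ e.+1 =
        v * s3 * (u ^+ 0 * v ^+ c * s2 ^+ 0 * s3 ^+ e) by rewrite !exprS; ring.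
    by apply: sm small_vs3 (ff _ _ _ _); lia.
  case: c nE => [|[|[|c]]] nE; last first.
  (* The power v ^ 4 is reached through v (u s3), where uv is already small. *)
  + have -> : u ^+ 0 * v ^+ c.+4 * s2 ^+ 0 * s3 ^+ 0 =
        u * v * (u ^+ 0 * v ^+ c * s2 ^+ 0 * s3 ^+ 1)
        - (u * s3 - v ^+ 3) * (u ^+ 0 * v ^+ c.+1 * s2 ^+ 0 * s3 ^+ 0).
      by rewrite !exprS; ring.
    apply: spannedD; first by apply: sm small_uv (ff _ _ _ _); lia.
    by apply: spannedN; apply: sm small_us3 (ff _ _ _ _); lia.
  + rewrite !expr0 mul1r !mulr1; exact: (spanned_basis (i := 6)).
  + rewrite !expr0 mul1r !mulr1; exact: (spanned_basis (i := 5)).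
  + rewrite !expr0 mul1r !mulr1; exact: (spanned_basis (i := 2)).
rewrite !expr0 !mul1r.
case: d nE => [|[|[|d]]] nE.
- case: e nE => [|[|e]] nE.
  + by rewrite mul1r; apply: (spanned_basis (i := 0)).
  + by rewrite mul1r; apply: (spanned_basis (i := 4)).
  have -> : s2 ^+ 0 * s3 ^+ e.+2 =
      s3 ^+ 2 * (u ^+ 0 * v ^+ 0 * s2 ^+ 0 * s3 ^+ e) by rewrite !exprS; ring.
  by apply: sm small_s3s3 (ff _ _ _ _); lia.
- case: e nE => [|e] nE.
    by rewrite mulr1; apply: (spanned_basis (i := 3)).
  have -> : s2 ^+ 1 * s3 ^+ e.+1 =
      s2 * s3 * (u ^+ 0 * v ^+ 0 * s2 ^+ 0 * s3 ^+ e) by rewrite !exprS; ring.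
  by apply: sm small_s2s3 (ff _ _ _ _); lia.
- case: e nE => [|e] nE; last first.
    have -> : s2 ^+ 2 * s3 ^+ e.+1 =
        s2 * s3 * (u ^+ 0 * v ^+ 0 * s2 ^+ 1 * s3 ^+ e) by rewrite !exprS; ring.
    by apply: sm small_s2s3 (ff _ _ _ _); lia.
  have -> : s2 ^+ 2 * s3 ^+ 0 =
      (s2 ^+ 2 - u * s3) * 1 + ((u * s3 - v ^+ 3) * 1 + v ^+ 3) by ring.
  apply: spannedD; first by apply: sm small_s2s2 filt1; lia.
  apply: spannedD; last exact: (spanned_basis (i := 6)).
  by apply: sm small_us3 filt1; lia.
(* The cube s2 ^ 3 is traded for u s2 s3, where u s2 is small. *)
have -> : s2 ^+ d.+3 * s3 ^+ e =
    (s2 ^+ 2 - u * s3) * (u ^+ 0 * v ^+ 0 * s2 ^+ d.+1 * s3 ^+ e)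
    + u * s2 * (u ^+ 0 * v ^+ 0 * s2 ^+ d * s3 ^+ e.+1) by rewrite !exprS; ring.
apply: spannedD; first by apply: sm small_s2s2 (ff _ _ _ _); lia.
by apply: sm small_us2 (ff _ _ _ _); lia.
Qed.

Lemma spanned_wmon n a : wmon n a -> spanned a.
Proof.
elim/ltn_ind: n a => n IH a na.
have {}IH m b : (m < n)%N -> filt m b -> spanned b.
  by move=> lt_mn; apply: spanned_filt => k c le_km; apply: IH; apply: leq_ltn_trans lt_mn.
have [|[b [c [d [e [nE ->]]]]]] := wmon_small_or_fib na.
  exact: spanned_small.
exact: spanned_fib nE.
Qed.

Lemma Pi_spanned (p : {mpoly K[19]}) : spanned (mmap kappa (fun i => x i) p).
Proof.
suff [n pn] : exists n, filt n (mmap kappa (fun i => x i) p).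
  by apply: spanned_filt pn => m b _; apply: spanned_wmon.
elim/mpoly_gen_ind: p => [c|i|p q [m pm] [n qn]|p q [m pm] [n qn]].
- by exists 0%N; rewrite mmapC; apply: filtC.
- rewrite mmapX mmap1U.
  have fX k a : filt k a -> exists n, filt n a by exists k.
  case: i; do 19?[case=> [|]] => //= *; eapply fX; solve_filt.
- by exists (maxn m n); rewrite rmorphD; apply: filtD.
- by exists (m + n)%N; rewrite rmorphM; apply: filtM.
Qed.

End Span.

(** * Independence of the generators *)

(* Multiplication by [u] and [v] on the fibre over the points of the
   parameter space where the matrix of the [p_i] is the identity and the only
   other nonzero coordinates are [L123], [L124], [L125], [L126]; the basis is
   [1, u, v, s2, s3, v ^ 2, v ^ 3]. *)
Section FibreMatrices.

Variables (P : comNzRingType) (y1 y2 y3 y4 : P).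

Definition row7 (s : seq P) : 'rV[P]_7 := \row_j s`_j.

(** Row [i] is the product of the [i]th basis element by u. The entries come from v s2 = - y1, u s2
    = s3 + y2, uv = s3 - y3 and u ^ 2 = v ^ 2 + s2 + y4, which are the values of L123, L124, L125,
    L126 at these points; for example v s3 = - y1 u - y2 v. *)
Definition fibre_u : 'M[P]_7 := \matrix_i row7 (nth [::]
  [:: [:: 0; 1; 0; 0; 0; 0; 0];
      [:: y4; 0; 0; 1; 0; 1; 0];
      [:: - y3; 0; 0; 0; 1; 0; 0];
      [:: y2; 0; 0; 0; 1; 0; 0];
      [:: - y1; y3; y4; 0; 0; 0; 1];
      [:: 0; - y1; - (y2 + y3); 0; 0; 0; 0];
      [:: y1 * y3; 0; 0; 0; - y1; - (y2 + y3); 0]] i).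

Definition fibre_v : 'M[P]_7 := \matrix_i row7 (nth [::]
  [:: [:: 0; 0; 1; 0; 0; 0; 0];
      [:: - y3; 0; 0; 0; 1; 0; 0];
      [:: 0; 0; 0; 0; 0; 1; 0];
      [:: - y1; 0; 0; 0; 0; 0; 0];
      [:: 0; - y1; - y2; 0; 0; 0; 0];
      [:: 0; 0; 0; 0; 0; 0; 1];
      [:: (y2 + y3) * y3 - y1 * y4; 0; y1; - y1; - (y2 + y3); - (y1 + y4); 0]] i).

Definition fibre_s2 := fibre_u *m fibre_u - fibre_v *m fibre_v - y4%:M.
Definition fibre_s3 := fibre_u *m fibre_v + y3%:M.

Lemma row7_fibre_u a0 a1 a2 a3 a4 a5 a6 :
  row7 [:: a0; a1; a2; a3; a4; a5; a6] *m fibre_u =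
  row7 [:: a1 * y4 - a2 * y3 + a3 * y2 - a4 * y1 + a6 * (y1 * y3);
           a0 + a4 * y3 - a5 * y1; a4 * y4 - a5 * (y2 + y3); a1;
           a2 + a3 - a6 * y1; a1 - a6 * (y2 + y3); a4].
Proof.
apply/rowP => j; rewrite !mxE !big_ord_recl big_ord0 !mxE /=.
by case: j; do 7?[case=> [|]]; rewrite //= => *; ring.
Qed.

Lemma row7_fibre_v a0 a1 a2 a3 a4 a5 a6 :
  row7 [:: a0; a1; a2; a3; a4; a5; a6] *m fibre_v =
  row7 [:: a6 * ((y2 + y3) * y3 - y1 * y4) - a1 * y3 - a3 * y1;
           - (a4 * y1); a0 - a4 * y2 + a6 * y1; - (a6 * y1);
           a1 - a6 * (y2 + y3); a2 - a6 * (y1 + y4); a5].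
Proof.
apply/rowP => j; rewrite !mxE !big_ord_recl big_ord0 !mxE /=.
by case: j; do 7?[case=> [|]]; rewrite //= => *; ring.
Qed.

Lemma row7_scalar a0 a1 a2 a3 a4 a5 a6 c :
  row7 [:: a0; a1; a2; a3; a4; a5; a6] *m c%:M =
  row7 [:: c * a0; c * a1; c * a2; c * a3; c * a4; c * a5; c * a6].
Proof.
rewrite mul_mx_scalar; apply/rowP => j; rewrite !mxE.
by case: j; do 7?[case=> [|]].
Qed.

Lemma row7D a0 a1 a2 a3 a4 a5 a6 b0 b1 b2 b3 b4 b5 b6 :
  row7 [:: a0; a1; a2; a3; a4; a5; a6] + row7 [:: b0; b1; b2; b3; b4; b5; b6] =
  row7 [:: a0 + b0; a1 + b1; a2 + b2; a3 + b3; a4 + b4; a5 + b5; a6 + b6].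
Proof. by apply/rowP => j; rewrite !mxE; case: j; do 7?[case=> [|]]. Qed.

Lemma row7N a0 a1 a2 a3 a4 a5 a6 :
  - row7 [:: a0; a1; a2; a3; a4; a5; a6] =
  row7 [:: - a0; - a1; - a2; - a3; - a4; - a5; - a6].
Proof. by apply/rowP => j; rewrite !mxE; case: j; do 7?[case=> [|]]. Qed.

(** Testing on one symbolic row lets a product of matrices act factor by factor, without expanding
    the product itself. *)
Lemma row7_mxP (A B : 'M[P]_7) :
  (forall a0 a1 a2 a3 a4 a5 a6,
     row7 [:: a0; a1; a2; a3; a4; a5; a6] *m A =
     row7 [:: a0; a1; a2; a3; a4; a5; a6] *m B) -> A = B.
Proof.
move=> AB; apply/row_matrixP => i; rewrite !rowE.
suff -> : delta_mx 0 i = row7 [:: (delta_mx 0 i : 'rV[P]_7) 0 (inord 0);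
    (delta_mx 0 i : 'rV[P]_7) 0 (inord 1); (delta_mx 0 i : 'rV[P]_7) 0 (inord 2);
    (delta_mx 0 i : 'rV[P]_7) 0 (inord 3); (delta_mx 0 i : 'rV[P]_7) 0 (inord 4);
    (delta_mx 0 i : 'rV[P]_7) 0 (inord 5); (delta_mx 0 i : 'rV[P]_7) 0 (inord 6)] by [].
apply/rowP => j; rewrite [RHS]mxE -[j in LHS]inord_val.
by case: j; do 7?[case=> [|]].
Qed.

Let mulE := (mulmxA, mulmxDr, mulmxBr, mulmxN, row7_fibre_u, row7_fibre_v,
  row7_scalar, row7N, row7D).

Lemma fibre_uvC : fibre_u *m fibre_v = fibre_v *m fibre_u.
Proof.
apply: row7_mxP => *; rewrite !mulE.
by congr (row7 [:: _; _; _; _; _; _; _]); ring.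
Qed.

Lemma fibre_y1 : - (fibre_v *m fibre_s2) = y1%:M.
Proof.
apply: row7_mxP => *; rewrite !mulE.
by congr (row7 [:: _; _; _; _; _; _; _]); ring.
Qed.

Lemma fibre_y2 : fibre_u *m fibre_s2 - fibre_s3 = y2%:M.
Proof.
apply: row7_mxP => *; rewrite !mulE.
by congr (row7 [:: _; _; _; _; _; _; _]); ring.
Qed.

Lemma row7_basis :
  let e := row7 [:: 1; 0; 0; 0; 0; 0; 0] in
  [/\ e *m fibre_u = row7 [:: 0; 1; 0; 0; 0; 0; 0],
      e *m fibre_v = row7 [:: 0; 0; 1; 0; 0; 0; 0],
      e *m fibre_s2 = row7 [:: 0; 0; 0; 1; 0; 0; 0],
      e *m fibre_s3 = row7 [:: 0; 0; 0; 0; 1; 0; 0] &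
      e *m (fibre_v *m fibre_v) = row7 [:: 0; 0; 0; 0; 0; 1; 0] /\
      e *m (fibre_v *m (fibre_v *m fibre_v)) = row7 [:: 0; 0; 0; 0; 0; 0; 1]].
Proof.
split; last split; rewrite !mulE;
  by congr (row7 [:: _; _; _; _; _; _; _]); ring.
Qed.

Lemma fibre_comm : commr_rmorph (horner_mx fibre_v) fibre_u.
Proof. by move=> p; apply: comm_mx_horner; apply: fibre_uvC. Qed.

Definition fibre_rep : {poly {poly P}} -> 'M[P]_7 := horner_morph fibre_comm.

HB.instance Definition _ := GRing.RMorphism.on fibre_rep.

Definition poly_s2 : {poly {poly P}} := 'X ^+ 2 - 'X%:P ^+ 2 - y4%:P%:P.
Definition poly_s3 : {poly {poly P}} := 'X * 'X%:P + y3%:P%:P.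

Lemma fibre_repX : fibre_rep 'X = fibre_u.
Proof. exact: horner_morphX. Qed.

Lemma fibre_repCX : fibre_rep 'X%:P = fibre_v.
Proof. exact: etrans (horner_morphC _ _) (horner_mx_X _). Qed.

Lemma fibre_repCC p : fibre_rep p%:P%:P = p%:M.
Proof. exact: etrans (horner_morphC _ _) (horner_mx_C _ _). Qed.

Lemma fibre_rep_s2 : fibre_rep poly_s2 = fibre_s2.
Proof. by rewrite !rmorphB !rmorphXn /= fibre_repX fibre_repCX fibre_repCC. Qed.

Lemma fibre_rep_s3 : fibre_rep poly_s3 = fibre_s3.
Proof. by rewrite rmorphD rmorphM /= fibre_repX fibre_repCX fibre_repCC. Qed.

Lemma fibre_rep_y1 : fibre_rep (- ('X%:P * poly_s2)) = y1%:M.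
Proof. by rewrite rmorphN rmorphM /= fibre_repCX fibre_rep_s2 -fibre_y1. Qed.

Lemma fibre_rep_y2 : fibre_rep ('X * poly_s2 - poly_s3) = y2%:M.
Proof. by rewrite rmorphB rmorphM /= fibre_repX fibre_rep_s2 fibre_rep_s3 -fibre_y2. Qed.

Lemma row7_fibre_rep (c : 'I_7 -> P) :
  row7 [:: 1; 0; 0; 0; 0; 0; 0] *m
    fibre_rep (\sum_i (c i)%:P%:P *
      [:: 1; 'X; 'X%:P; poly_s2; poly_s3; 'X%:P ^+ 2; 'X%:P ^+ 3]`_i) = \row_i c i.
Proof.
have [eu ev es2 es3 [ev2 ev3]] := row7_basis.
rewrite rmorph_sum mulmx_sumr (eq_bigr (fun i => c i *: delta_mx 0 i)).
  by rewrite [RHS]row_sum_delta; apply: eq_bigr => i _; rewrite mxE.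
move=> i _; rewrite rmorphM /= fibre_repCC -mulmxE mulmxA mul_mx_scalar -scalemxAl.
congr (_ *: _); have -> : delta_mx 0 i = row7 (nth [::]
  [:: [:: 1; 0; 0; 0; 0; 0; 0]; [:: 0; 1; 0; 0; 0; 0; 0];
      [:: 0; 0; 1; 0; 0; 0; 0]; [:: 0; 0; 0; 1; 0; 0; 0];
      [:: 0; 0; 0; 0; 1; 0; 0]; [:: 0; 0; 0; 0; 0; 1; 0];
      [:: 0; 0; 0; 0; 0; 0; 1]] i).
  apply/rowP => j; rewrite !mxE /=.
  case: i => [[|[|[|[|[|[|[|//]]]]]]] lt_i]; case: j => [[|[|[|[|[|[|[|//]]]]]]] lt_j] //.
case: i => [[|[|[|[|[|[|[|//]]]]]]] lt_i] /=.
- by rewrite rmorph1 mulmx1.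
- by rewrite fibre_repX.
- by rewrite fibre_repCX.
- by rewrite fibre_rep_s2.
- by rewrite fibre_rep_s3.
- by rewrite rmorphXn /= fibre_repCX expr2.
- by rewrite rmorphXn /= fibre_repCX !exprS mulr1.
Qed.

End FibreMatrices.

(* Numerators of [L123], [L124], [L125], [L126] over [Delta], in terms of the
   other coordinates, [L246 - v] and [s1 - u]. *)
Section Numerators.

Variables (A : comNzRingType) (y : nat -> A).

Local Notation p1 := (y 0%N).
Local Notation p2 := (y 1%N).
Local Notation p4 := (y 2%N).
Local Notation t1 := (y 3%N).
Local Notation t2 := (y 4%N).
Local Notation L135 := (y 5%N).
Local Notation L136 := (y 6%N).
Local Notation L245 := (y 7%N).
Local Notation u := (y 10%N).
Local Notation v := (y 11%N).
Local Notation s2 := (y 12%N).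
Local Notation s3 := (y 13%N).
Local Notation p3 := (y 14%N).
Local Notation L246 := (y 8%N + v).
Local Notation s1 := (y 9%N + u).
Local Notation la X Y Z := (L136 * X + L245 * Y + L246 * Z).
Local Notation mu X Y Z := (L135 * X + L136 * Y + L245 * Z).
Local Notation u1 := (p1 ^+ 2 + t1 * p2 ^+ 2 + p2 * u).
Local Notation u2 := (2 * p1 * p3 + 2 * t1 * p2 * p4 + p4 * u + p2 * v).
Local Notation u3 := (p3 ^+ 2 + t1 * p4 ^+ 2 + p4 * v).
Local Notation i1 := (t2 * p2 ^+ 2 + p1 * u).
Local Notation i2 := (2 * t2 * p2 * p4 + p3 * u + p1 * v).
Local Notation i3 := (t2 * p4 ^+ 2 + p3 * v).

Definition Pi_num : seq A :=
  [:: t2 * p4 * s1 - (v + t1 * p4) * s2 + p3 * s3 - mu i1 i2 i3;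
      - t2 * p2 * s1 + (u + t1 * p2) * s2 - p1 * s3 - la i1 i2 i3;
      - (v * s1 - p3 * s2 - p4 * s3 + mu u1 u2 u3);
      u * s1 - p1 * s2 - p2 * s3 - la u1 u2 u3].

Definition Pi_Delta := p1 * p4 - p2 * p3.

Definition Pi_chart (d : A) : nat -> A := nth 0
  [:: p1; p2; p3; p4; u; v; t1; t2; Pi_num`_0 * d; Pi_num`_1 * d; Pi_num`_2 * d;
      Pi_num`_3 * d; L135; L136; L245; L246; s1; s2; s3].

Lemma Pi_chart_point d :
  is_domain A -> d * Pi_Delta = 1 -> Pi_point (Pi_chart d).
Proof.
move=> domA dD.
have Dd b : b * d * Pi_Delta = b by rewrite -mulrA dD mulr1.
apply: Pi_point_of_Delta => //.
- by move=> D0; have /eqP := dD; rewrite /Pi_Delta [_ - _]D0 mulr0 eq_sym oner_eq0.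
- by rewrite /rel1 /Pi_chart /= -/Pi_Delta Dd; ring.
- by rewrite /rel2 /Pi_chart /= -/Pi_Delta Dd; ring.
- by rewrite /rel3 /Pi_chart /= -/Pi_Delta Dd; ring.
- by rewrite /rel4 /Pi_chart /= -/Pi_Delta Dd; ring.
Qed.

End Numerators.

Lemma Pi_num_morph (A B : comNzRingType) (g : {rmorphism A -> B}) y :
  map g (Pi_num y) = Pi_num (g \o y).
Proof.
have gD a a' b b' : g a = a' -> g b = b' -> g (a + b) = a' + b'.
  by move=> <- <-; rewrite rmorphD.
have gN a a' : g a = a' -> g (- a) = - a' by move=> <-; rewrite rmorphN.
have gM a a' b b' : g a = a' -> g b = b' -> g (a * b) = a' * b'.
  by move=> <- <-; rewrite rmorphM.
have gX a a' n : g a = a' -> g (a ^+ n) = a' ^+ n by move=> <-; rewrite rmorphXn.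
have gn n : g n%:R = n%:R by rewrite rmorph_nat.
rewrite /Pi_num; congr [:: _; _; _; _].
all: repeat lazymatch goal with
  | |- _ (_ + _) = _ => apply gD
  | |- _ (- _) = _ => apply gN
  | |- _ (_ * _) = _ => apply gM
  | |- _ (_ ^+ _) = _ => apply gX
  | |- _ (_ %:R) = _ => apply gn
  | |- _ => reflexivity
  end.
Qed.

Section Independence.

Variable K : fieldType.
Local Notation B := {mpoly K[15]}.
Local Notation X k := ('X_(inord k) : B).

Definition subst n (E : comNzRingType) (c : {rmorphism K -> E}) (s : nat -> E) :
  {mpoly K[n.+1]} -> E := mmap c (fun i => s i).

HB.instance Definition _ n (E : comNzRingType) (c : {rmorphism K -> E}) s :=
  GRing.RMorphism.on (@subst n E c s).

Lemma substX n (E : comNzRingType) (c : {rmorphism K -> E}) s k :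
  (k < n.+1)%N -> @subst n E c s 'X_(inord k) = s k.
Proof. by move=> lt_k; rewrite /subst mmapX mmap1U inordK. Qed.

Lemma substC n (E : comNzRingType) (c : {rmorphism K -> E}) s a :
  @subst n E c s a%:MP = c a.
Proof. by rewrite /subst mmapC. Qed.

Lemma hom_ext_inord n (E : nzRingType) (f g : {rmorphism {mpoly K[n.+1]} -> E}) :
  (forall c, f c%:MP = g c%:MP) ->
  (forall k, (k < n.+1)%N -> f 'X_(inord k) = g 'X_(inord k)) -> f =1 g.
Proof.
move=> fgC fgX; apply: mpoly_hom_ext => // i.
by rewrite -(inord_val i); apply/fgX/ltn_ord.
Qed.

Local Notation subst15 := (@subst 14).

Definition var15 (k : nat) : B := X k.

(* The parameters in terms of the coordinates of the chart, up to the factor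
   [Delta] on [L123], [L124], [L125], [L126]. *)
Definition num_subst (E : comNzRingType) (y : nat -> E) : nat -> E := fun k =>
  if (10 <= k < 14)%N then (Pi_num y)`_(k - 10) else y k.

(** At p1 = p4 = 1 and p2 = p3 = 0 the value of [Delta] is 1: the special point stays in the
    chart. *)
Definition fibre_point (k : nat) : nat := (k == 0%N) || (k == 2%N).

(** These four positions hold L123, L124, L125, L126 among the parameters and u, v, s2, s3 among the
    chart coordinates; the other eleven agree in both lists. *)
Definition is_fib (k : nat) := (10 <= k < 14)%N.

Definition fibre_coord (k : nat) : B := if is_fib k then X k else (fibre_point k)%:R.

Lemma Pi_num_fibre : Pi_num fibre_coord =
  [:: - (X 11 * X 12); X 10 * X 12 - X 13; X 13 - X 10 * X 11;
      X 10 ^+ 2 - X 12 - X 11 ^+ 2].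
Proof.
rewrite /Pi_num /fibre_coord /fibre_point /=.
by congr [:: _; _; _; _]; ring.
Qed.

Lemma nth_rmorph (E F : comNzRingType) (g : {rmorphism E -> F}) (s : seq E) k :
  g s`_k = (map g s)`_k.
Proof.
have [lt_k|le_k] := ltnP k (size s); first by rewrite (nth_map 0).
by rewrite !nth_default ?size_map // rmorph0.
Qed.

Lemma Pi_num_fibre_morph (E : comNzRingType) (g : {rmorphism B -> E}) :
  map g (Pi_num fibre_coord) =
  [:: - (g (X 11) * g (X 12)); g (X 10) * g (X 12) - g (X 13);
      g (X 13) - g (X 10) * g (X 11); g (X 10) ^+ 2 - g (X 12) - g (X 11) ^+ 2].
Proof.
by rewrite Pi_num_fibre /= !(rmorphN, rmorphB, rmorphM, rmorphXn).
Qed.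

Definition basis15 (E : comNzRingType) (y : nat -> E) : seq E :=
  [:: 1; y 10%N; y 11%N; y 12%N; y 13%N; y 11%N ^+ 2; y 11%N ^+ 3].

Definition fibre_subst (k : nat) : B :=
  if is_fib k then (Pi_num fibre_coord)`_(k - 10) else X k.

Let rep := fibre_rep (X 10) (X 11) (X 12) (X 13).
Let ps2 := poly_s2 (X 13).
Let ps3 := poly_s3 (X 12).

Let cst : B -> {poly {poly B}} := fun p => p%:P%:P.

(** [subst] has a commutative target, so the matrices are reached through polynomials in u and v.
    The numerators of L125 and L126 at the special point are what expresses s3 and s2 in these
    two. *)
Definition fibre_lift : B -> {poly {poly B}} :=
  subst15 (polyC \o (polyC \o @mpolyC 15 K)) (fun k =>
    if is_fib k then [:: 'X; 'X%:P; ps2; ps3]`_(k - 10) else cst (X k)).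

HB.instance Definition _ := GRing.RMorphism.on fibre_lift.

Lemma fibre_liftX : [/\ fibre_lift (X 10) = 'X, fibre_lift (X 11) = 'X%:P,
  fibre_lift (X 12) = ps2 & fibre_lift (X 13) = ps3].
Proof. by split; rewrite /fibre_lift substX. Qed.

(** The four numerators act as scalars: those of L125 and L126 by the choice of [ps3] and [ps2],
    those of L123 and L124 by [fibre_y1] and [fibre_y2]. *)
Lemma rep_lift_subst p :
  rep (fibre_lift (subst15 (@mpolyC 15 K) fibre_subst p)) = p%:M.
Proof.
move: p; apply: (hom_ext_inord
  (f := rep \o (fibre_lift \o subst15 (@mpolyC 15 K) fibre_subst))
  (g := @scalar_mx B 7)) => [c|k lt_k] /=.
  by rewrite substC /fibre_lift substC /= [LHS]fibre_repCC.
rewrite substX // /fibre_subst; case: ifP => [|kf]; last first.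
  by rewrite /fibre_lift substX // kf [LHS]fibre_repCC.
have -> : fibre_lift (Pi_num fibre_coord)`_(k - 10) =
    [:: - ('X%:P * ps2); 'X * ps2 - ps3; ps3 - 'X * 'X%:P;
        'X ^+ 2 - ps2 - 'X%:P ^+ 2]`_(k - 10).
  have [<- <- <- <-] := fibre_liftX.
  by rewrite [LHS]nth_rmorph; congr nth; apply: Pi_num_fibre_morph.
rewrite /is_fib; move: k lt_k; do 10?[case=> [|] //].
case=> [_ _|]; last case=> [_ _|]; last case=> [_ _|]; last case=> [_ _|//] /=.
- exact: fibre_rep_y1.
- exact: fibre_rep_y2.
- rewrite /ps3 /poly_s3.
  have -> (a b : {poly {poly B}}) : a + b - a = b by ring.
  exact: fibre_repCC.
- rewrite /ps2 /poly_s2.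
  have -> (a b c : {poly {poly B}}) : a - (a - b - c) - b = c by ring.
  exact: fibre_repCC.
Qed.

(** Acting on the row of the basis element 1, the sum produces the row of its own coefficients. *)
Lemma fibre_free (c : 'I_7 -> B) :
  \sum_i subst15 (@mpolyC 15 K) fibre_subst (c i) * (basis15 var15)`_i = 0 ->
  forall i, c i = 0.
Proof.
move=> c0 i; have [Xu Xv Xs2 Xs3] := fibre_liftX.
have := row7_fibre_rep (X 10) (X 11) (X 12) (X 13) c; rewrite -/rep.
have -> : rep (\sum_i (c i)%:P%:P *
      [:: 1; 'X; 'X%:P; ps2; ps3; 'X%:P ^+ 2; 'X%:P ^+ 3]`_i) =
    rep (fibre_lift (\sum_i subst15 (@mpolyC 15 K) fibre_subst (c i) *
           (basis15 var15)`_i)).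
  rewrite (rmorph_sum fibre_lift) /rep !rmorph_sum; apply: eq_bigr => j _.
  rewrite (rmorphM fibre_lift) !rmorphM -/rep.
  congr (_ * rep _); first exact: etrans (fibre_repCC _ _ _ _ _) (esym (rep_lift_subst (c j))).
  case: j => [[|[|[|[|[|[|[|//]]]]]]] lt_j] /=;
  by rewrite ?rmorphXn ?rmorph1 /= /var15 ?Xu ?Xv ?Xs2 ?Xs3.
by rewrite c0 (rmorph0 fibre_lift) /rep rmorph0 mulmx0 => /rowP/(_ i); rewrite !mxE.
Qed.

End Independence.

Lemma Pi_num_ext (A : comNzRingType) (y y' : nat -> A) :
  (forall k, (k < 15)%N -> y k = y' k) -> Pi_num y = Pi_num y'.
Proof. by move=> yy'; rewrite /Pi_num !yy'. Qed.

(** * Independence at the generic point by degeneration *)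

Section Deformation.

Variable K : fieldType.
Local Notation B := {mpoly K[15]}.
Local Notation X k := ('X_(inord k) : B).
Local Notation var := (var15 K).
Local Notation subB := (@subst K 14 _ (@mpolyC 15 K)).

(* [deform] joins the generic point, at ['X = 1], to the special point
   [fibre_point], at ['X = 0]. *)
Definition deform : B -> {poly B} := @subst K 14 _ (polyC \o @mpolyC 15 K) (fun k =>
  if is_fib k then (X k)%:P else (fibre_point k)%:R + 'X * (X k)%:P).

HB.instance Definition _ := GRing.RMorphism.on deform.

Definition num_hom : B -> B := subB (num_subst var).

HB.instance Definition _ := GRing.RMorphism.on num_hom.

Definition deform_num0 : B -> {poly B} := @subst K 14 _ (polyC \o @mpolyC 15 K) (fun k =>
  if is_fib k then deform (Pi_num var)`_(k - 10) else (X k)%:P).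

HB.instance Definition _ := GRing.RMorphism.on deform_num0.

Definition deform_num : {poly B} -> {poly B} :=
  horner_eval 'X \o map_poly deform_num0.

HB.instance Definition _ := GRing.RMorphism.on deform_num.

Lemma deform_numC c : deform_num c%:P = deform_num0 c.
Proof. by rewrite /deform_num /= map_polyC /= /horner_eval hornerC. Qed.

Lemma deform_numX : deform_num 'X = 'X.
Proof. by rewrite /deform_num /= map_polyX /horner_eval hornerX. Qed.

(** This commuting square carries a dependence at the generic point to polynomials in 'X, where it
    can be specialized at 0. *)
Lemma deform_num_hom p : deform (num_hom p) = deform_num (deform p).
Proof.
move: p; apply: (hom_ext_inord (f := deform \o num_hom) (g := deform_num \o deform)).
  move=> c /=; rewrite /num_hom substC /deform !substC /=.
  by rewrite [RHS]deform_numC /deform_num0 substC.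
move=> k lt_k /=; rewrite /num_hom substX // /num_subst -/(is_fib k).
case: ifP => kf; rewrite /deform !substX // kf.
  by rewrite [RHS]deform_numC /deform_num0 substX // kf.
rewrite rmorphD rmorphM rmorph_nat /= deform_numX deform_numC.
by rewrite /deform_num0 substX // kf.
Qed.

Lemma deform_at0 k : (k < 15)%N -> (deform (X k)).[0] = fibre_coord K k.
Proof.
move=> lt_k; rewrite /deform substX // /fibre_coord; case: ifP => _.
  by rewrite hornerC.
by rewrite hornerD hornerM hornerX mul0r addr0 -polyC_natr hornerC.
Qed.

Lemma deform_num0_at0 p : (deform_num0 p).[0] = subB (fibre_subst K) p.
Proof.
move: p; apply: (hom_ext_inord (f := horner_eval 0 \o deform_num0)).
  by move=> c /=; rewrite /deform_num0 !substC /= /horner_eval hornerC.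
move=> k lt_k /=; rewrite /deform_num0 !substX // /fibre_subst /horner_eval.
case: ifP => _; last by rewrite hornerC.
have := nth_rmorph (horner_eval (0 : B) \o deform) (Pi_num var) (k - 10).
rewrite Pi_num_morph => gE; rewrite [LHS]gE; congr nth.
by apply: Pi_num_ext => j lt_j /=; rewrite /horner_eval deform_at0.
Qed.

Lemma deform_num_at0 q : (deform_num q).[0] = subB (fibre_subst K) q`_0.
Proof.
elim/poly_ind: q => [|q c _]; first by rewrite coef0 !rmorph0 horner0.
rewrite coefD coefMX coefC /= add0r rmorphD rmorphM /= deform_numX deform_numC.
by rewrite hornerD hornerM hornerX mulr0 add0r deform_num0_at0.
Qed.

(** At 'X = 1 the deformation is a translation of the coordinates, which [unshift] undoes. *)
Lemma deform_inj0 p : deform p = 0 -> p = 0.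
Proof.
pose unshift := subB (fun k => if is_fib k then X k else X k - (fibre_point k)%:R).
move=> p0; suff <- : unshift (deform p).[1] = p by rewrite p0 horner0 /unshift rmorph0.
move: p {p0}; apply: (hom_ext_inord (f := unshift \o (horner_eval 1 \o deform)) (g := idfun)).
  by move=> c; rewrite /= /deform substC /horner_eval /= hornerC /unshift substC.
move=> k lt_k; rewrite /= /deform substX // /horner_eval; case: ifP => kf.
  by rewrite hornerC /unshift substX // kf.
rewrite hornerD hornerM hornerX mul1r -polyC_natr !hornerC.
by rewrite /unshift rmorphD rmorph_nat /= substX // kf addrC subrK.
Qed.

Lemma deform_basis j : deform (basis15 var)`_j = ((basis15 var)`_j)%:P.
Proof.
rewrite (nth_rmorph deform).
apply: etrans (esym (nth_rmorph polyC (basis15 var) j)); congr nth.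
rewrite /basis15 /= !rmorph1 !rmorphXn /= /var15.
by rewrite /deform !substX.
Qed.

(** At 'X = 0 the special fibre forces all constant terms to vanish; then 'X divides every [q i],
    and the quotients satisfy the same equation with smaller size. *)
Lemma deform_num_free (q : 'I_7 -> {poly B}) :
  \sum_i deform_num (q i) * ((basis15 var)`_i)%:P = 0 -> forall i, q i = 0.
Proof.
have [n] : exists n, forall i, (size (q i) <= n)%N.
  by exists (\max_i size (q i)) => i; apply: (leq_bigmax i).
elim: n q => [|n IH] q le_n q0 i.
  by apply/eqP; rewrite -size_poly_eq0 -leqn0.
have qE j : q j = ((q j)`_0)%:P + drop_poly 1 (q j) * 'X.
  rewrite -[LHS](poly_take_drop 1) expr1; congr (_ + _).
  by apply/polyP => -[|k]; rewrite coef_take_poly coefC.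
have q00 : forall j, (q j)`_0 = 0.
  apply: (@fibre_free K (fun j => (q j)`_0)).
  transitivity (horner_eval 0 (\sum_i deform_num (q i) * ((basis15 var)`_i)%:P)).
    rewrite rmorph_sum; apply: eq_bigr => j _.
    by rewrite rmorphM /= /horner_eval hornerC deform_num_at0.
  by rewrite q0 rmorph0.
have {}qE j : q j = drop_poly 1 (q j) * 'X by rewrite {1}qE q00 polyC0 add0r.
suff q'0 : forall j, drop_poly 1 (q j) = 0 by rewrite qE q'0 mul0r.
apply: IH => [j|]; first by rewrite size_drop_poly leq_subLR add1n.
have X0 : ('X : {poly B}) <> 0 by apply/eqP; rewrite polyX_eq0.
apply: (domain_mulIf (@idomain_is_domain _) X0); rewrite mul0r -[RHS]q0 mulr_suml.
apply: eq_bigr => j _; rewrite [in RHS]qE rmorphM /= deform_numX.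
by rewrite mulrAC.
Qed.

Lemma num_free (c : 'I_7 -> B) :
  \sum_i num_hom (c i) * (basis15 var)`_i = 0 -> forall i, c i = 0.
Proof.
move=> c0 i; apply/deform_inj0/(deform_num_free (q := deform \o c)).
apply: etrans (etrans (congr1 deform c0) (rmorph0 deform)).
apply: etrans (esym (rmorph_sum deform _ _ _)); apply: eq_bigr => j _.
apply: etrans (esym (rmorphM deform _ _)).
by rewrite -deform_num_hom -deform_basis.
Qed.

Definition Delta15 : B := Pi_Delta var.

(** In the chart the four parameters are [Pi_num] over [Delta]; multiplying them by [Delta] turns
    evaluation of the parameters into [num_hom], which has no denominators. *)
Definition scale_hom : B -> B :=
  subB (fun k => if is_fib k then Delta15 * X k else X k).

HB.instance Definition _ := GRing.RMorphism.on scale_hom.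

Lemma scale_Delta15 : scale_hom Delta15 = Delta15.
Proof.
rewrite /Delta15 /Pi_Delta /scale_hom rmorphB !rmorphM /= /var15.
by rewrite !substX.
Qed.

Lemma scale_hom_lift c : exists n c', scale_hom c' = Delta15 ^+ n * c.
Proof.
elim/mpoly_gen_ind: c => [a|i|p q|p q].
- by exists 0%N, a%:MP; rewrite /scale_hom substC mul1r.
- rewrite -(inord_val i); have := substX (@mpolyC 15 K)
    (fun k => if is_fib k then Delta15 * X k else X k) (ltn_ord i).
  case: ifP => _ iE; first by exists 1%N, (X i); rewrite expr1.
  by exists 0%N, (X i); rewrite mul1r.
- move=> [m [p' pE]] [n [q' qE]].
  exists (m + n)%N, (Delta15 ^+ n * p' + Delta15 ^+ m * q').
  by rewrite rmorphD !rmorphM !rmorphXn /= scale_Delta15 pE qE exprD; ring.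
move=> [m [p' pE]] [n [q' qE]]; exists (m + n)%N, (p' * q').
by rewrite rmorphM /= pE qE exprD; ring.
Qed.

Lemma Delta15_neq0 : Delta15 <> 0.
Proof.
pose h := @subst K 14 _ (idfun : K -> K) (fun k => (fibre_point k)%:R).
move/(congr1 h); rewrite /h rmorph0 /Delta15 /Pi_Delta rmorphB !rmorphM /= /var15.
rewrite !substX //= mulr1 mul0r subr0; exact/eqP/oner_neq0.
Qed.

Lemma chart_free (E : comNzRingType) (iota : {rmorphism B -> E}) (d : E)
    (c : 'I_7 -> B) (x := Pi_chart (iota \o var) d) :
  is_domain E -> injective iota -> d * iota Delta15 = 1 ->
  \sum_i par_eval (iota \o @mpolyC 15 K) x (c i) * (Pi_basis x)`_i = 0 ->
  forall i, c i = 0.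
Proof.
move=> domE iota_inj dD c0.
have [n [c' c'E]] : exists n (c' : 'I_7 -> B),
    forall i, scale_hom (c' i) = Delta15 ^+ n * c i.
  have /choice[n /choice[c' c'E]] := fun i => scale_hom_lift (c i).
  exists (\sum_i n i)%N, (fun i => Delta15 ^+ (\sum_(j | j != i) n j) * c' i) => i.
  rewrite rmorphM rmorphXn /= scale_Delta15 c'E mulrA -exprD.
  by rewrite [in RHS](bigD1 i) //= addnC.
have par_scale p : par_eval (iota \o @mpolyC 15 K) x (scale_hom p) =
    iota (num_hom p).
  move: p; apply: (hom_ext_inord (f := par_eval (iota \o @mpolyC 15 K) x \o scale_hom)
    (g := iota \o num_hom)).
    by move=> a /=; rewrite /scale_hom /num_hom !substC /par_eval mmapC.
  have parX k : (k < 15)%N -> par_eval (iota \o @mpolyC 15 K) x (X k) = (Pi_par x)`_k.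
    by move=> lt_k; rewrite /par_eval mmapX mmap1U inordK.
  move=> k lt_k /=; rewrite /scale_hom /num_hom !substX // /num_subst -/(is_fib k).
  case: ifP => kf.
    rewrite rmorphM /= (parX k) //.
    have -> : par_eval (iota \o @mpolyC 15 K) x Delta15 = iota Delta15.
      by rewrite /Delta15 /Pi_Delta !rmorphB !rmorphM /= /var15 !parX.
    have -> : (Pi_par x)`_k = (Pi_num (iota \o var))`_(k - 10) * d.
      by move: k kf {lt_k}; do 10?[case=> [|] //]; do 4?[case=> [|] //].
    by rewrite mulrCA (mulrC _ d) dD mulr1 nth_rmorph Pi_num_morph.
  rewrite (parX k) //; move: k kf lt_k; rewrite /x /Pi_par /Pi_chart /=.
  by do 15?[case=> [|] //=]; rewrite ?addrK.
have DE0 : Delta15 ^+ n <> 0.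
  exact/domain_expf_neq0/Delta15_neq0/idomain_is_domain.
have c'0 : forall i, c' i = 0.
  apply: num_free; apply: iota_inj; rewrite rmorph0 rmorph_sum /=.
  transitivity (par_eval (iota \o @mpolyC 15 K) x (Delta15 ^+ n) *
    \sum_i par_eval (iota \o @mpolyC 15 K) x (c i) * (Pi_basis x)`_i).
    rewrite mulr_sumr; apply: eq_bigr => i _.
    have parM := rmorphM (par_eval (iota \o @mpolyC 15 K) x).
    rewrite mulrA -[Y in _ = Y * _]parM -c'E [Y in _ = Y * _]par_scale rmorphM.
    congr (_ * _); rewrite nth_rmorph; congr nth.
    by rewrite /basis15 /Pi_basis /= rmorph1 !rmorphXn.
  by rewrite c0 mulr0.
move=> i; apply: (domain_mulfI (@idomain_is_domain _) DE0).
by rewrite mulr0 -c'E c'0 rmorph0.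
Qed.

End Deformation.

(** * The divisor [Delta = 0] *)

(* Coordinates on the chart of the divisor [Delta = 0] where [p2] and the
   cubic form do not vanish. *)
Definition Delta0_coords (A : comNzRingType) (x : nat -> A) : seq A :=
  [:: x 0%N; x 1%N; x 3%N; x 6%N; x 1%N * x 5%N - x 3%N * x 4%N; x 16%N; x 17%N;
      x 12%N; x 13%N; x 14%N; x 15%N; x 1%N * x 8%N + x 3%N * x 9%N; x 10%N; x 11%N].

Ltac solve_G := repeat first [assumption | lazymatch goal with
  | |- ?P (_ %:R) => match goal with H : forall n, P n%:R |- _ => exact: H end
  | |- ?P (_ + _) => match goal with H : forall a b, P a -> P b -> P (a + b) |- _ => apply H end
  | |- ?P (- _) => match goal with H : forall a, P a -> P (- a) |- _ => apply H end
  | |- ?P (_ * _) => match goal with H : forall a b, P a -> P b -> P (a * b) |- _ => apply H end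
  | |- ?P (_ ^+ _) => match goal with H : forall a n, P a -> P (a ^+ n) |- _ => apply H end
  end].

Section Delta0Induction.

Variables (A : comNzRingType) (x : nat -> A).
Hypothesis xP : Pi_point x.

Local Notation p1 := (x 0%N).
Local Notation p2 := (x 1%N).
Local Notation p3 := (x 2%N).
Local Notation p4 := (x 3%N).
Local Notation u := (x 4%N).
Local Notation v := (x 5%N).
Local Notation t1 := (x 6%N).
Local Notation t2 := (x 7%N).
Local Notation L123 := (x 8%N).
Local Notation L124 := (x 9%N).
Local Notation L125 := (x 10%N).
Local Notation L126 := (x 11%N).
Local Notation L135 := (x 12%N).
Local Notation L136 := (x 13%N).
Local Notation L245 := (x 14%N).
Local Notation L246 := (x 15%N).
Local Notation s1 := (x 16%N).
Local Notation s2 := (x 17%N).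
Local Notation s3 := (x 18%N).
Local Notation Dl := (p1 * p4 - p2 * p3).
Local Notation la X Y Z := (L136 * X + L245 * Y + L246 * Z).
Local Notation mu X Y Z := (L135 * X + L136 * Y + L245 * Z).
Local Notation u1 := (p1 ^+ 2 + t1 * p2 ^+ 2 + p2 * u).
Local Notation u2 := (2 * p1 * p3 + 2 * t1 * p2 * p4 + p4 * u + p2 * v).
Local Notation u3 := (p3 ^+ 2 + t1 * p4 ^+ 2 + p4 * v).
Local Notation i1 := (t2 * p2 ^+ 2 + p1 * u).
Local Notation k1 := (L135 * L245 - L136 ^+ 2).
Local Notation k2 := (L135 * L246 - L136 * L245).
Local Notation k3 := (L136 * L246 - L245 ^+ 2).
Local Notation qf := (L136 * p2 ^+ 2 + 2 * L245 * p2 * p4 + L246 * p4 ^+ 2).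
Local Notation w := (p2 * v - p4 * u).
Local Notation f := (cubic_form x).

Variable G : A -> Prop.
Hypothesis G_nat : forall n, G n%:R.
Hypothesis G_add : forall a b, G a -> G b -> G (a + b).
Hypothesis G_opp : forall a, G a -> G (- a).
Hypothesis G_mul : forall a b, G a -> G b -> G (a * b).
Hypothesis G_Delta : forall a, G (Dl * a).
Hypothesis G_cancel_p2 : forall a, G (p2 * a) -> G a.
Hypothesis G_cancel_f : forall a, G (f * a) -> G a.
Hypothesis G_coords : forall k, (k < 14)%N -> G (Delta0_coords x)`_k.

(** [G] abstracts being polynomial in the fourteen coordinates modulo [Delta], up to powers of p2
    and [f]. The missing coordinates are solved in the order p3, u, v, t2, s3, L124, L123. *)
Lemma Delta0_ind k : (k < 19)%N -> G (x k).
Proof.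
have G_exp a n : G a -> G (a ^+ n).
  move=> Ga; elim: n => [|n IH]; first by rewrite expr0; exact: (G_nat 1).
  by rewrite exprS; apply: (G_mul).
have Gp1 : G p1 := G_coords (k := 0) isT.
have Gp2 : G p2 := G_coords (k := 1) isT.
have Gp4 : G p4 := G_coords (k := 2) isT.
have Gt1 : G t1 := G_coords (k := 3) isT.
have Gw : G w := G_coords (k := 4) isT.
have Gs1 : G s1 := G_coords (k := 5) isT.
have Gs2 : G s2 := G_coords (k := 6) isT.
have GL135 : G L135 := G_coords (k := 7) isT.
have GL136 : G L136 := G_coords (k := 8) isT.
have GL245 : G L245 := G_coords (k := 9) isT.
have GL246 : G L246 := G_coords (k := 10) isT.
have GX : G (p2 * L123 + p4 * L124) := G_coords (k := 11) isT.
have GL125 : G L125 := G_coords (k := 12) isT.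
have GL126 : G L126 := G_coords (k := 13) isT.
set XX := p2 * L123 + p4 * L124 in GX.
set ww := p2 * v - p4 * u in Gw.
have [r1 r2 r3 r4 r7] : [/\ rel1 x = 0, rel2 x = 0, rel3 x = 0, rel4 x = 0 & rel7 x = 0].
  by split; [exact: (xP 0)|exact: (xP 1)|exact: (xP 2)|exact: (xP 3)|exact: (xP 6)].
have Gp3 : G p3.
  apply: (G_cancel_p2); have -> : p2 * p3 = p1 * p4 - Dl * 1 by ring.
  have := G_Delta 1; set D1 := Dl * 1 => GD; solve_G.
have Gu : G u.
  apply/G_cancel_p2/G_cancel_f.
  have := rel12_eq x; rewrite r1 r2 !mulr0 subrr mulr0 -/ww.
  set D1 := Dl * _; have GD : G D1 by apply: G_Delta.
  move/esym/(canRL (addrK _))/(canRL (addrK _)); rewrite sub0r => E.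
  have -> : f * (p2 * u) = - D1 - p2 * ww * (p2 * s1 + qf)
      - f * (p1 ^+ 2 + t1 * p2 ^+ 2) by rewrite -E; ring.
  rewrite /cubic_form; solve_G.
have Gv : G v.
  apply: (G_cancel_p2); have -> : p2 * v = ww + p4 * u by rewrite /ww; ring.
  solve_G.
have Gt2 : G t2.
  apply/G_cancel_p2/G_cancel_p2/G_cancel_f.
  have := rel34_eq x; rewrite r3 r4 !mulr0 subrr mulr0 -/ww.
  set D1 := Dl * _; have GD : G D1 by apply: G_Delta.
  move/esym/(canRL (addrK _))/(canRL (addrK _)); rewrite sub0r => E.
  have -> : f * (p2 * (p2 * t2)) = - D1 - ww * (p2 ^+ 2 * s2 + p1 * qf)
      - f * (p1 * u) by rewrite -E; ring.
  rewrite /cubic_form; solve_G.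
have Gs3 : G s3.
  apply: (G_cancel_p2).
  have -> : p2 * s3 = u * s1 - p1 * s2 - L126 * Dl - la u1 u2 u3.
    by apply/esym/subr0_eq; rewrite -r1 /rel1; ring.
  solve_G.
have GL124 : G L124.
  apply: (G_cancel_f); have := rel7_eq x; rewrite r7 mulr0 -/XX => E.
  move: E; set rest := (Y in _ = _ + Y) => E.
  have -> : f * L124 = (p2 * s1 + qf) * XX + rest.
    by apply/esym/subr0_eq; rewrite [RHS]E; ring.
  rewrite /rest; solve_G.
have GL123 : G L123.
  apply: (G_cancel_p2); have -> : p2 * L123 = XX - p4 * L124 by rewrite /XX; ring.
  solve_G.
by do 19?[case: k => [|k] //].
Qed.

End Delta0Induction.

(** The equations solved in [Delta0_ind] are used here as definitions, so the fourteen coordinates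
    can be prescribed freely away from p2 [f] = 0. *)
Lemma Delta0_point (F : fieldType) (z : nat -> F)
    (f := z 7%N * z 1%N ^+ 3 + 3 * z 8%N * z 1%N ^+ 2 * z 2%N
          + 3 * z 9%N * z 1%N * z 2%N ^+ 2 + z 10%N * z 2%N ^+ 3) :
  z 1%N != 0 -> f != 0 ->
  exists x, [/\ Pi_point x, x 0%N * x 3%N - x 1%N * x 2%N = 0,
    forall k, (k < 14)%N -> (Delta0_coords x)`_k = z k & cubic_form x = f].
Proof.
move=> p20 f0.
pose p1 := z 0%N; pose p2 := z 1%N; pose p4 := z 2%N; pose t1 := z 3%N.
pose w := z 4%N; pose s1 := z 5%N; pose s2 := z 6%N; pose L135 := z 7%N.
pose L136 := z 8%N; pose L245 := z 9%N; pose L246 := z 10%N; pose XX := z 11%N.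
pose L125 := z 12%N; pose L126 := z 13%N.
pose qf := L136 * p2 ^+ 2 + 2 * L245 * p2 * p4 + L246 * p4 ^+ 2.
pose p3 := p1 * p4 / p2.
pose u := (- (p2 * w * (p2 * s1 + qf)) / f - p1 ^+ 2 - t1 * p2 ^+ 2) / p2.
pose v := (w + p4 * u) / p2.
pose t2 := (- (w * (p2 ^+ 2 * s2 + p1 * qf)) / f - p1 * u) / p2 ^+ 2.
pose la a b c := L136 * a + L245 * b + L246 * c.
pose mu a b c := L135 * a + L136 * b + L245 * c.
pose s3 := (u * s1 - p1 * s2 - la (p1 ^+ 2 + t1 * p2 ^+ 2 + p2 * u)
  (2 * p1 * p3 + 2 * t1 * p2 * p4 + p4 * u + p2 * v)
  (p3 ^+ 2 + t1 * p4 ^+ 2 + p4 * v)) / p2.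
pose rest := - s2 ^+ 2 + s1 * s3 - (L125 * p2 + L126 * p4) * s2
  - L125 * la (p1 * p2) (p2 * p3 + p1 * p4) (p3 * p4)
  + L126 * mu (p1 * p2) (p2 * p3 + p1 * p4) (p3 * p4)
  + (L135 * L245 - L136 ^+ 2) * (- p1 ^+ 2 + 2 * u * p2 + t1 * p2 ^+ 2)
  + (L135 * L246 - L136 * L245) * (- p1 * p3 + u * p4 + v * p2 + t1 * p2 * p4)
  + (L136 * L246 - L245 ^+ 2) * (- p3 ^+ 2 + 2 * v * p4 + t1 * p4 ^+ 2).
pose L124 := ((p2 * s1 + qf) * XX + p2 * rest) / f.
pose L123 := (XX - p4 * L124) / p2.
pose x : nat -> F := nth 0 [:: p1; p2; p3; p4; u; v; t1; t2; L123; L124; L125; L126;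
  L135; L136; L245; L246; s1; s2; s3].
have p2K a : p2 * (a / p2) = a by rewrite mulrCA divff ?mulr1.
have fK a : f * (a / f) = a by rewrite mulrCA divff ?mulr1.
have Dl0 : p1 * p4 - p2 * p3 = 0 by rewrite p2K subrr.
have wE : p2 * v - p4 * u = w by rewrite p2K addrK.
have XXE : p2 * L123 + p4 * L124 = XX by rewrite p2K subrK.
have xE : forall k, (k < 14)%N -> (Delta0_coords x)`_k = z k.
  by do 14?[case=> [|] //=]; rewrite /x /=.
have fE : cubic_form x = f by [].
exists x; split=> //.
have domF := @idomain_is_domain F.
have p2_0 : p2 <> 0 by apply/eqP.
apply: Pi_point_of_Delta0 => //.
- by rewrite /cubic_form /x /=; apply/eqP.
- apply: (domain_mulfI domF p2_0); rewrite mulr0 /rel1 /x /= Dl0 mulr0 subr0.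
  have s3E := p2K (u * s1 - p1 * s2 - la (p1 ^+ 2 + t1 * p2 ^+ 2 + p2 * u)
  (2 * p1 * p3 + 2 * t1 * p2 * p4 + p4 * u + p2 * v)
  (p3 ^+ 2 + t1 * p4 ^+ 2 + p4 * v)); rewrite -/s3 in s3E.
  by rewrite s3E /la; ring.
- apply: (domain_mulfI domF p2_0); rewrite mulr0 rel7_eq.
  rewrite fE /x /= XXE.
  have L124E := fK ((p2 * s1 + qf) * XX + p2 * rest); rewrite -/L124 in L124E.
  rewrite L124E /rest /la /mu /qf; ring.
- rewrite fE /x /= wE -/qf.
  have -> : p1 ^+ 2 + t1 * p2 ^+ 2 + p2 * u = - (p2 * w * (p2 * s1 + qf)) / f.
    by rewrite p2K; ring.
  exact: fK.
rewrite fE /x /= wE -/qf.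
have -> : t2 * p2 ^+ 2 + p1 * u = - (w * (p2 ^+ 2 * s2 + p1 * qf)) / f.
  by rewrite /t2 divfK ?subrK // expf_neq0.
exact: fK.
Qed.

(** * Primes and degrees in polynomial rings over a field *)

Section MPolyPrime.

Variable K : fieldType.

Lemma mpoly_unit n (p : {mpoly K[n]}) : p != 0 -> (msize p <= 1)%N -> is_unit p.
Proof.
move=> p0 /msize1_polyC pE; rewrite pE in p0 *.
by exists (p@_0)^-1%:MP; rewrite -mpolyCM mulVf // -(mpolyC_eq0 n).
Qed.

Lemma mpoly_separated n (d c : {mpoly K[n]}) : (1 < msize d)%N -> c <> 0 ->
  exists k, ~ divides (d ^+ k) c.
Proof.
move=> d1 c0; exists (msize c) => -[q cE].
have d0 : d != 0 by rewrite -msize_poly_eq0 -lt0n ltnW.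
have q0 : q != 0 by apply/eqP => q0; apply: c0; rewrite cE q0 mul0r.
have le_k k : (k < msize (q * d ^+ k))%N.
  elim: k => [|k IH]; first by rewrite mulr1 lt0n msize_poly_eq0.
  rewrite exprSr mulrA msizeM ?mulf_neq0 ?expf_neq0 //.
  by move: d1 IH; case: (msize d) => [|[|s]] // _ IH; rewrite !addnS /= ltnS ltn_addr.
by have := le_k (msize c); rewrite -cE ltnn.
Qed.

Lemma mpoly_X_coprime n (i j : 'I_n) (p : {mpoly K[n]}) : i != j ->
  prime_elt p -> divides p 'X_i -> ~ divides p 'X_j.
Proof.
move=> ij [p0 pU _] [c iE] [d jE].
have sz := congr1 (fun q : {mpoly K[n]} => msize q) iE.
have X0 : 'X_i != 0 :> {mpoly K[n]} by rewrite -msize_poly_eq0 msizeX mdeg1.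
have c0 : c != 0 by apply: contra_neq X0 => c0; rewrite iE c0 mul0r.
have [p_le|p_gt] := leqP (msize p) 1; first by apply/pU/mpoly_unit => //; apply/eqP.
have c_le : (msize c <= 1)%N.
  move: sz; rewrite msizeX mdeg1 msizeM //; last exact/eqP.
  by case: (msize p) p_gt => [|[|s]] // _; case: (msize c) => [|[|t]] //; rewrite !addnS.
have [e ec] := mpoly_unit c0 c_le.
(* By degrees [p] is associated to 'X_i, so 'X_i would divide 'X_j; setting 'X_i to 0 refutes
   this. *)
pose h := mmap (@mpolyC n K) (fun k => if k == i then 0 else 'X_k).
have hX k : h 'X_k = if k == i then 0 else 'X_k by rewrite /h mmapX mmap1U.
have /(congr1 h) : 'X_j = d * e * 'X_i.
  by rewrite jE iE [in RHS]mulrA -(mulrA d) ec mulr1.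
rewrite /h rmorphM /= -!/(h _) !hX eqxx eq_sym (negPf ij) mulr0.
by move/eqP; rewrite -msize_poly_eq0 msizeX mdeg1.
Qed.

Lemma mpoly_to_poly_inord n k : (k < n.+1)%N ->
  mpoly_to_poly ('X_(inord k) : {mpoly K[n.+2]}) = ('X_(inord k))%:P.
Proof.
move=> lt_k; rewrite -mpoly_to_poly_lift; congr (mpoly_to_poly 'X__).
apply/val_inj; rewrite /= inordK ?(ltnW (lt_k : k.+1 < n.+2)%N) // /bump.
by rewrite inordK // leqNgt lt_k.
Qed.

(** As a polynomial in p3 it is - p2 p3 + p1 p4, linear with coprime coefficients. *)
Lemma Delta15_prime : prime_elt (Delta15 K).
Proof.
suff : prime_elt (mpoly_to_poly (Delta15 K)).
  by move/(iso_prime (@mpoly_to_polyK K 14) (@poly_to_mpolyK K 14)).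
have -> : mpoly_to_poly (Delta15 K) =
    (- 'X_(inord 1)) *: 'X + ('X_(inord 0) * 'X_(inord 2))%:P.
  rewrite /Delta15 /Pi_Delta /var15 rmorphB !rmorphM /=.
  have -> : inord 14 = ord_max :> 'I_15 by apply/val_inj; rewrite /= inordK.
  rewrite !mpoly_to_poly_inord // mpoly_to_poly_max.
  by rewrite -mul_polyC polyCN; ring.
apply: linear_prime; first exact: mpoly_factorial.
  by apply/eqP; rewrite oppr_eq0 -msize_poly_eq0 msizeX mdeg1.
move=> p pP /dividesN; rewrite opprK => p1; have [_ _ pM] := pP.
by case/pM; apply: mpoly_X_coprime p1 => //; rewrite -val_eqE /= !inordK.
Qed.

Lemma Delta15_msize : (1 < msize (Delta15 K))%N.
Proof.
rewrite ltnNge; apply/negP => le1; have [D0 DU _] := Delta15_prime.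
by apply/DU/mpoly_unit => //; apply/eqP.
Qed.

End MPolyPrime.

Lemma par_evalX (K E : comNzRingType) (c : {rmorphism K -> E}) x k :
  (k < 15)%N -> par_eval c x 'X_(inord k) = (Pi_par x)`_k.
Proof. by move=> lt_k; rewrite /par_eval mmapX mmap1U inordK. Qed.

(** * The coordinate ring as a free module and as a domain *)

Section CoordinateRing.

Local Open Scope quotient_scope.

Variable K : fieldType.
Local Notation S := {mpoly K[19]}.
Local Notation R := (R_Pi K).
Local Notation B := {mpoly K[15]}.
Local Notation X k := ('X_(inord k) : B).

Definition Pi_proj : S -> R := \pi_(R_Pi K).

HB.instance Definition _ := GRing.RMorphism.on Pi_proj.

Definition Pi_coord (k : nat) : R := Pi_proj (Pi_var K k).

Definition scal : K -> R := Pi_proj \o @mpolyC 19 K.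

HB.instance Definition _ := GRing.RMorphism.on scal.

Lemma Pi_proj_eq0 a : Pi_proj a = 0 <-> in_generated_ideal (@Pi_gens K) a.
Proof.
pose I : idealr (S_Pi K) := @I_Pi K.
have aE : (a \in I) = (a == 0 %[mod {ideal_quot I}]).
  by rewrite -[in LHS](subr0 a) Quotient.idealrBE.
have p0 : \pi_{ideal_quot I} (0 : S_Pi K) = 0 by exact: (rmorph0 Pi_proj).
split=> [a0|aI].
  have : a \in I by rewrite aE p0; apply/eqP.
  by move=> /asboolP.
have : a \in I by apply/asboolP.
by rewrite aE p0 => /eqP.
Qed.

Lemma Pi_proj_surj r : exists a, Pi_proj a = r.
Proof. by exists (repr r); apply: reprK. Qed.

Lemma ev_Pi_proj (E : comNzRingType) (c : {rmorphism K -> E}) h a :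
  Pi_point h -> Pi_proj a = 0 -> @subst K 18 E c h a = 0.
Proof.
move=> hP /Pi_proj_eq0[b ->]; rewrite rmorph_sum big1 // => i _.
rewrite rmorphM Pi_gensE /= (nth_rmorph (subst c h)) rels_morph.
by rewrite (@rels_ext _ _ h) ?hP ?mulr0 // => k lt_k /=; rewrite substX.
Qed.

Lemma Pi_coord_point : Pi_point Pi_coord.
Proof.
move=> k; have -> : rels Pi_coord = map Pi_proj (rels (Pi_var K)).
  by rewrite rels_morph.
rewrite -(nth_rmorph Pi_proj); have [lt_k|le_k] := ltnP k 9; last first.
  by rewrite nth_default // rmorph0.
rewrite -(Pi_gensE K (Ordinal lt_k)); apply/Pi_proj_eq0.
exists (fun j => (j == Ordinal lt_k)%:R).
rewrite (bigD1 (Ordinal lt_k)) //= eqxx mul1r big1 ?addr0 // => j /negPf->.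
by rewrite mul0r.
Qed.

Lemma Pi_projE a : Pi_proj a = @subst K 18 R scal Pi_coord a.
Proof.
move: a; apply: (hom_ext_inord (f := Pi_proj)) => [c|k lt_k] /=.
  by rewrite substC.
by rewrite substX.
Qed.

Local Notation par := (par_eval scal Pi_coord).

Lemma R_spanned r : exists c : 'I_7 -> B, r = \sum_i par (c i) * (Pi_basis Pi_coord)`_i.
Proof.
have [a <-] := Pi_proj_surj r; rewrite Pi_projE.
exact: (Pi_spanned scal Pi_coord_point).
Qed.

Definition parS : B -> S := par_eval (@mpolyC 19 K) (Pi_var K).

HB.instance Definition _ := GRing.RMorphism.on parS.

Lemma Pi_par_morph (E F : comNzRingType) (g : {rmorphism E -> F}) x :
  map g (Pi_par x) = Pi_par (g \o x).
Proof. by rewrite /Pi_par /= !rmorphB. Qed.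

Lemma Pi_basis_morph (E F : comNzRingType) (g : {rmorphism E -> F}) x :
  map g (Pi_basis x) = Pi_basis (g \o x).
Proof. by rewrite /Pi_basis /= rmorph1 !rmorphXn. Qed.

Lemma par_eval_morph (E F : comNzRingType) (g : {rmorphism E -> F})
    (c : {rmorphism K -> E}) (x : nat -> E) p :
  g (par_eval c x p) = par_eval (g \o c) (g \o x) p.
Proof.
move: p; apply: (hom_ext_inord (f := g \o par_eval c x)) => [a|k lt_k] /=.
  by rewrite -!par_eval_C.
by rewrite !par_evalX // nth_rmorph Pi_par_morph.
Qed.

Lemma par_eval_ext (E : comNzRingType) (c c' : {rmorphism K -> E}) (x y : nat -> E) p :
  c =1 c' -> (forall k, (k < 19)%N -> x k = y k) -> par_eval c x p = par_eval c' y p.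
Proof.
move=> cc' xy; move: p; apply: (hom_ext_inord (f := par_eval c x)) => [a|k lt_k] /=.
  by rewrite -!par_eval_C.
by rewrite !par_evalX // /Pi_par !xy.
Qed.

Definition combS (c : 'I_7 -> B) : S :=
  \sum_i parS (c i) * (Pi_basis (Pi_var K))`_i.

Lemma Pi_proj_combS c : Pi_proj (combS c) = \sum_i par (c i) * (Pi_basis Pi_coord)`_i.
Proof.
rewrite (rmorph_sum Pi_proj); apply: eq_bigr => i _.
rewrite (rmorphM Pi_proj) (nth_rmorph Pi_proj) Pi_basis_morph; congr (_ * _).
by rewrite /parS (par_eval_morph Pi_proj); apply: par_eval_ext.
Qed.

Lemma ev_combS (E : comNzRingType) (k : {rmorphism K -> E}) h c :
  @subst K 18 E k h (combS c) = \sum_i par_eval k h (c i) * (Pi_basis h)`_i.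
Proof.
rewrite (rmorph_sum (subst k h)); apply: eq_bigr => i _.
rewrite (rmorphM (subst k h)) (nth_rmorph (subst k h)) Pi_basis_morph; congr (_ * _).
  rewrite /parS (par_eval_morph (subst k h)); apply: par_eval_ext => [a|j lt_j] /=.
    by rewrite substC.
  by rewrite substX.
by rewrite /Pi_basis /= !substX.
Qed.

Local Notation FB := {fraction B}.
Let iotaF : {rmorphism B -> FB} := @tofrac _.
Let dF : FB := (iotaF (Delta15 K))^-1.
Let hF := Pi_chart (iotaF \o var15 K) dF.
Let scalF : {rmorphism K -> FB} := iotaF \o @mpolyC 15 K.
Let evF := @subst K 18 FB scalF hF.

Lemma iotaF_inj : injective iotaF.
Proof. by move=> a b /eqP; rewrite tofrac_eq => /eqP. Qed.

Lemma dF_Delta : dF * iotaF (Delta15 K) = 1.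
Proof.
rewrite /dF mulVf //; apply/eqP => D0; apply: (@Delta15_neq0 K).
by apply: iotaF_inj; rewrite D0 [RHS]rmorph0.
Qed.

Lemma hF_point : Pi_point hF.
Proof.
apply: Pi_chart_point; first exact: idomain_is_domain.
rewrite -[RHS]dF_Delta; congr (_ * _).
by rewrite /Delta15 /Pi_Delta (rmorphB iotaF) !(rmorphM iotaF).
Qed.

Lemma evF_combS c : evF (combS c) = 0 -> forall i, c i = 0.
Proof.
rewrite /evF ev_combS; apply: (chart_free (iota := iotaF) (d := dF)).
- exact: idomain_is_domain.
- exact: iotaF_inj.
- exact: dF_Delta.
Qed.

Lemma R_free (c : 'I_7 -> B) :
  \sum_i par (c i) * (Pi_basis Pi_coord)`_i = 0 -> forall i, c i = 0.
Proof.
rewrite -Pi_proj_combS => c0; apply: evF_combS.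
exact: ev_Pi_proj hF_point c0.
Qed.

(** Modulo the ideal, [a] is a combination of the seven generators; evaluation at the generic point
    of the chart preserves it, and independence there kills its coefficients. *)
Lemma evF_inj a : evF a = 0 -> Pi_proj a = 0.
Proof.
move=> a0; have [c aE] := R_spanned (Pi_proj a).
rewrite -Pi_proj_combS in aE.
have ab0 : Pi_proj (a - combS c) = 0 by rewrite (rmorphB Pi_proj) /= aE subrr.
have := ev_Pi_proj scalF hF_point ab0; rewrite (rmorphB (subst scalF hF)).
move/subr0_eq; rewrite [LHS]a0 => /esym/evF_combS c0.
rewrite aE Pi_proj_combS big1 // => i _.
by rewrite c0 (rmorph0 par) mul0r.
Qed.

Lemma R_domain : is_domain R.
Proof.
move=> r s; have [a <-] := Pi_proj_surj r; have [b <-] := Pi_proj_surj s.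
rewrite -(rmorphM Pi_proj) => /(ev_Pi_proj scalF hF_point).
rewrite (rmorphM (subst scalF hF)) => /idomain_is_domain[]/evF_inj; tauto.
Qed.

Definition chart_vars (E : comNzRingType) (x : nat -> E) : seq E :=
  [:: x 0%N; x 1%N; x 3%N; x 6%N; x 7%N; x 12%N; x 13%N; x 14%N;
      x 15%N - x 5%N; x 16%N - x 4%N; x 4%N; x 5%N; x 17%N; x 18%N; x 2%N].

Definition chartR : B -> R := @subst K 14 R scal (fun k => (chart_vars Pi_coord)`_k).

HB.instance Definition _ := GRing.RMorphism.on chartR.

Lemma chartR_inj : injective chartR.
Proof.
pose iotaS := @subst K 14 S (@mpolyC 19 K) (fun k => (chart_vars (Pi_var K))`_k).
have RS p : chartR p = Pi_proj (iotaS p).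
  move: p; apply: (hom_ext_inord (f := chartR) (g := Pi_proj \o iotaS)) => [a|k lt_k] /=.
    by rewrite /chartR /iotaS !substC.
  rewrite /chartR /iotaS !substX // (nth_rmorph Pi_proj); congr nth.
  by rewrite /chart_vars /= !(rmorphB Pi_proj).
have evS p : evF (iotaS p) = iotaF p.
  move: p; apply: (hom_ext_inord (f := subst scalF hF \o iotaS) (g := iotaF)) => [a|k lt_k] /=.
    by rewrite /iotaS !substC.
  rewrite /iotaS substX // (nth_rmorph (subst scalF hF)) /chart_vars /=.
  rewrite !(rmorphB (subst scalF hF)) /= !substX //.
  rewrite /hF /Pi_chart /= !addrK.
  by move: k lt_k; do 15?[case=> [|] //=].
move=> p q pq; apply: iotaF_inj; apply/subr0_eq.
rewrite -!evS -(rmorphB (subst scalF hF)); apply: ev_Pi_proj; first exact: hF_point.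
by rewrite (rmorphB Pi_proj) /= -!RS pq subrr.
Qed.

Lemma chartR_Delta : chartR (Delta15 K) =
  Pi_coord 0 * Pi_coord 3 - Pi_coord 1 * Pi_coord 2.
Proof.
rewrite /Delta15 /Pi_Delta (rmorphB chartR) !(rmorphM chartR) /= /var15 /chartR.
by rewrite !substX.
Qed.

(** Two polynomial subrings are in play, [par] for freeness and [chartR] for Nagata's criterion.
    [Delta] lies in both, so its multiples can be recognized on coordinates over [par]. *)
Lemma par_Delta : par (Delta15 K) = chartR (Delta15 K).
Proof.
rewrite chartR_Delta /Delta15 /Pi_Delta (rmorphB par) !(rmorphM par) /= /var15.
by rewrite !par_evalX.
Qed.

Lemma R_clear r : exists n b, chartR (Delta15 K) ^+ n * r = chartR b.
Proof.
have [a <-] := Pi_proj_surj r; pose D := Delta15 K.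
have clear0 s b : s = chartR b -> exists n b', chartR D ^+ n * s = chartR b'.
  by move=> ->; exists 0%N, b; rewrite mul1r.
have iX k : (k < 15)%N -> chartR (X k) = (chart_vars Pi_coord)`_k.
  by move=> lt_k; rewrite /chartR substX.
have i15 : Pi_coord 15 = chartR (X 8 + X 11).
  by rewrite (rmorphD chartR) /= !iX //= subrK.
have i16 : Pi_coord 16 = chartR (X 9 + X 10).
  by rewrite (rmorphD chartR) /= !iX //= subrK.
have numE j : (Pi_num (fun k => (chart_vars Pi_coord)`_k))`_j = chartR (Pi_num (var15 K))`_j.
  rewrite (nth_rmorph chartR) Pi_num_morph; congr nth; apply: Pi_num_ext => k lt_k /=.
  by rewrite -iX.
have [r1 r2 r3 r4] : [/\ rel1 Pi_coord = 0, rel2 Pi_coord = 0, rel3 Pi_coord = 0 & rel4 Pi_coord = 0].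
  by split; [exact: (Pi_coord_point 0)|exact: (Pi_coord_point 1)
            |exact: (Pi_coord_point 2)|exact: (Pi_coord_point 3)].
elim/mpoly_gen_ind: a => [c|i|p q [m [a aE]] [n [b bE]]|p q [m [a aE]] [n [b bE]]].
- by apply: (clear0 _ c%:MP); rewrite /chartR substC.
- rewrite -(inord_val i); move: (nat_of_ord i) (ltn_ord i) => k lt_k.
  rewrite -[Pi_proj _]/(Pi_coord k).
  have cX j : (j < 15)%N -> exists n b, chartR D ^+ n * (chart_vars Pi_coord)`_j = chartR b.
    by move=> lt_j; apply: (clear0 _ (X j)); rewrite iX.
  have cN j s : chartR D * s = (Pi_num (fun k => (chart_vars Pi_coord)`_k))`_j ->
      exists n b, chartR D ^+ n * s = chartR b.
    by rewrite numE => sE; exists 1%N, (Pi_num (var15 K))`_j; rewrite expr1.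
  move: k lt_k; do 19?[case=> [_|]] => //.
  + exact: (cX 0%N).
  + exact: (cX 1%N).
  + exact: (cX 14%N).
  + exact: (cX 2%N).
  + exact: (cX 10%N).
  + exact: (cX 11%N).
  + exact: (cX 3%N).
  + exact: (cX 4%N).
  + apply: (cN 0%N); rewrite chartR_Delta; apply: subr0_eq.
    by rewrite -[RHS]r4 /rel4 /Pi_num /=; ring.
  + apply: (cN 1%N); rewrite chartR_Delta; apply: subr0_eq.
    by rewrite -[RHS]oppr0 -[in RHS]r3 /rel3 /Pi_num /=; ring.
  + apply: (cN 2%N); rewrite chartR_Delta; apply: subr0_eq.
    by rewrite -[RHS]r2 /rel2 /Pi_num /=; ring.
  + apply: (cN 3%N); rewrite chartR_Delta; apply: subr0_eq.
    by rewrite -[RHS]oppr0 -[in RHS]r1 /rel1 /Pi_num /=; ring.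
  + exact: (cX 5%N).
  + exact: (cX 6%N).
  + exact: (cX 7%N).
  + exact: clear0 i15.
  + exact: clear0 i16.
  + exact: (cX 12%N).
  + exact: (cX 13%N).
- exists (m + n)%N, (D ^+ n * a + D ^+ m * b).
  have -> : chartR (D ^+ n * a + D ^+ m * b) =
      chartR D ^+ n * chartR a + chartR D ^+ m * chartR b.
    by rewrite (rmorphD chartR) !(rmorphM chartR) !(rmorphXn chartR).
  have -> : Pi_proj (p + q) = Pi_proj p + Pi_proj q := rmorphD Pi_proj p q.
  by rewrite -aE -bE exprD mulrDr !mulrA (mulrC (_ ^+ n)).
- exists (m + n)%N, (a * b).
  have -> : chartR (a * b) = chartR a * chartR b := rmorphM chartR a b.
  have -> : Pi_proj (p * q) = Pi_proj p * Pi_proj q := rmorphM Pi_proj p q.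
  by rewrite -aE -bE exprD mulrACA.
Qed.

Lemma R_separated r : r <> 0 -> exists n, ~ divides (chartR (Delta15 K) ^+ n) r.
Proof.
have [c rE] := R_spanned r => r0.
have [i ci0] : exists i, c i <> 0.
  apply: contrapT => /forallNP c0; apply: r0; rewrite rE big1 // => i _.
  by have /contrapT -> := c0 i; rewrite (rmorph0 par) mul0r.
have [n nD] := mpoly_separated (Delta15_msize K) ci0.
exists n => -[r' r'E]; apply: nD; have [c' c'E] := R_spanned r'.
exists (c' i); apply/subr0_eq.
apply: (R_free (c := fun j => c j - c' j * Delta15 K ^+ n)).
transitivity (r - r' * chartR (Delta15 K) ^+ n); last by rewrite -r'E subrr.
rewrite rE c'E mulr_suml -sumrB; apply: eq_bigr => j _.
rewrite (rmorphB par) (rmorphM par) (rmorphXn par) /= par_Delta mulrBl.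
by rewrite [in RHS]mulrAC.
Qed.

End CoordinateRing.

(** * Regularity modulo [Delta] of the function inverted on the divisor *)

Section Delta0Unit.

Variable K : fieldType.
Local Notation S := {mpoly K[19]}.
Local Notation R := (R_Pi K).
Local Notation B := {mpoly K[15]}.
Local Notation X k := ('X_(inord k) : B).
Local Notation coord := (Pi_coord K).
Local Notation scal := (@scal K).
Local Notation Pi_proj := (@Pi_proj K).
Local Notation chartR := (@chartR K).
Local Notation par := (par_eval scal coord).

Definition Delta0_unit : R := coord 1 * cubic_form coord.

(* The matrix of multiplication by [Delta0_unit] has a determinant prime to
   [Delta]: at [p3 = p4 = 0] it is the scalar matrix [p2 ^ 4 * L135]. *)
Lemma Delta0_unit_nzd r : divides (chartR (Delta15 K)) (Delta0_unit * r) ->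
  divides (chartR (Delta15 K)) r.
Proof.
move=> [r' r'E]; have [a aE] := R_spanned r; have [a' a'E] := R_spanned r'.
have /choice[V VE] : forall i : 'I_7, exists V : 'I_7 -> B,
    coord 5 * (Pi_basis coord)`_i = \sum_j par (V j) * (Pi_basis coord)`_j.
  by move=> i; apply: R_spanned.
pose D := Delta15 K.
(* [X 8] stands for L246 - v, so the cubic form is [f0] plus p4 ^ 3 v. The matrix [V] of
   multiplication by v stays unknown; its contribution disappears at p4 = 0. *)
pose f0 : B := X 5 * X 1 ^+ 3 + 3 * X 6 * X 1 ^+ 2 * X 2
  + 3 * X 7 * X 1 * X 2 ^+ 2 + X 8 * X 2 ^+ 3.
pose Y : 'M[B]_7 := \matrix_(i, j)
  (X 1 * (f0 * (i == j)%:R + X 2 ^+ 3 * V i j)).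
have parX k : (k < 15)%N -> par (X k) = (Pi_par coord)`_k by exact: par_evalX.
have YE (i : 'I_7) : Delta0_unit * (Pi_basis coord)`_i =
    \sum_j par (Y i j) * (Pi_basis coord)`_j.
  transitivity (par (X 1 * f0) * (Pi_basis coord)`_i +
      par (X 1 * X 2 ^+ 3) * (coord 5 * (Pi_basis coord)`_i)).
    rewrite mulrA -mulrDl; congr (_ * _).
    rewrite /f0 !(rmorphM par, rmorphD par, rmorphXn par, rmorph_nat par) /= !parX //=.
    by rewrite /Delta0_unit /cubic_form; ring.
  rewrite VE mulr_sumr (bigD1 i) //= [in RHS](bigD1 i) //= addrA; congr (_ + _).
    rewrite !mxE eqxx mulr1 mulrA -mulrDl -!(rmorphM par) -(rmorphD par).
    by congr (par _ * _); ring.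
  apply: eq_bigr => j ji; rewrite !mxE eq_sym (negPf ji) mulr0 add0r mulrA.
  by rewrite -(rmorphM par) mulrA.
have aY (j : 'I_7) : \sum_i a i * Y i j = D * a' j.
  apply/subr0_eq.
  apply: (R_free (c := fun j => \sum_i a i * Y i j - D * a' j)).
  transitivity (Delta0_unit * r - r' * chartR D); last by rewrite r'E subrr.
  rewrite aE a'E mulr_suml mulr_sumr.
  have -> : \sum_i Delta0_unit * (par (a i) * (Pi_basis coord)`_i) =
      \sum_i \sum_j par (a i) * (par (Y i j) * (Pi_basis coord)`_j).
    by apply: eq_bigr => i _; rewrite mulrCA YE mulr_sumr.
  rewrite exchange_big -sumrB /=; apply: eq_bigr => j' _.
  rewrite (rmorphB par) (rmorphM par) (rmorph_sum par) /= par_Delta mulrBl.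
  rewrite -/D -[chartR D * _ * _]mulrA [chartR D * _]mulrC mulr_suml.
  congr (_ - _); apply: eq_bigr => i _.
  by rewrite (rmorphM par) /= -mulrA.
(* The adjugate isolates each coordinate; [D] is prime in [B], so it divides [a j] as soon as it
   does not divide the determinant. *)
have adjY (j : 'I_7) : \det Y * a j = D * \sum_i a' i * (\adj Y) i j.
  have /rowP/(_ j) : (\row_i a i) *m Y *m \adj Y = D *: ((\row_i a' i) *m \adj Y).
    rewrite scalemxAl; congr (_ *m _); apply/rowP => i; rewrite !mxE -aY.
    by apply: eq_bigr => k _; rewrite !mxE.
  rewrite -mulmxA mul_mx_adj mul_mx_scalar !mxE => ->; congr (_ * _).
  by apply: eq_bigr => i _; rewrite !mxE.
have detY : ~ divides D (\det Y).
  move=> [q qE]; pose sp := @subst K 14 B (@mpolyC 15 K)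
    (fun k => if (k == 2%N) || (k == 14%N) then 0 else X k).
  have spX k : (k < 15)%N -> sp (X k) = if (k == 2%N) || (k == 14%N) then 0 else X k.
    by move=> lt_k; rewrite /sp substX.
  have spD : sp D = 0.
    rewrite /sp /D /Delta15 /Pi_Delta rmorphB !rmorphM /= /var15 !substX //=.
    by rewrite !mulr0 subrr.
  have := congr1 sp qE; rewrite /sp rmorphM /= -/sp spD mulr0.
  rewrite -[LHS](det_map_mx (subst _ _)).
  have -> : map_mx sp Y = (X 1 ^+ 4 * X 5)%:M.
    apply/matrixP => i j; rewrite !mxE /f0 /sp.
    rewrite !(rmorphM, rmorphD, rmorphXn, rmorph_nat) /= !substX //=.
    by rewrite -mulr_natr; ring.
  rewrite det_scalar => /eqP; rewrite expf_eq0 /= mulf_eq0 expf_eq0 /=.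
  by rewrite -!msize_poly_eq0 !msizeX !mdeg1.
have /choice[b bE] : forall j, exists b, a j = b * D.
  move=> j; have [_ _ DM] := Delta15_prime K.
  have [|/detY//|//] := DM (\det Y) (a j).
  by rewrite adjY; exists (\sum_i a' i * (\adj Y) i j); rewrite mulrC.
exists (\sum_j par (b j) * (Pi_basis coord)`_j).
rewrite aE mulr_suml; apply: eq_bigr => j _.
by rewrite bE (rmorphM par) /= par_Delta mulrAC.
Qed.

End Delta0Unit.

(** * Clearing denominators modulo an element *)

Section Clearing.

Variables (T A : comNzRingType) (j : {rmorphism T -> A}) (D : A) (y : T).

Definition cleared (r : A) := exists n t r', j y ^+ n * r = j t + D * r'.

Lemma cleared_image t : cleared (j t).
Proof. by exists 0%N, t, 0; rewrite mul1r mulr0 addr0. Qed.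

Lemma cleared_multiple a : cleared (D * a).
Proof. by exists 0%N, 0, a; rewrite mul1r rmorph0 add0r. Qed.

Lemma clearedD a b : cleared a -> cleared b -> cleared (a + b).
Proof.
move=> [m [s [a' aE]]] [n [t [b' bE]]].
exists (m + n)%N, (y ^+ n * s + y ^+ m * t), (j y ^+ n * a' + j y ^+ m * b').
transitivity (j y ^+ n * (j y ^+ m * a) + j y ^+ m * (j y ^+ n * b)).
  by rewrite exprD; ring.
by rewrite aE bE rmorphD !rmorphM !rmorphXn; ring.
Qed.

Lemma clearedM a b : cleared a -> cleared b -> cleared (a * b).
Proof.
move=> [m [s [a' aE]]] [n [t [b' bE]]].
exists (m + n)%N, (s * t), (a' * (j t + D * b') + j s * b').
by rewrite exprD mulrACA aE bE rmorphM; ring.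
Qed.

Lemma clearedN a : cleared a -> cleared (- a).
Proof.
by move/(clearedM (cleared_image (- 1))); rewrite rmorphN rmorph1 mulN1r.
Qed.

Lemma cleared_cancel b c a : y = b * c -> cleared (j b * a) -> cleared a.
Proof.
move=> yE [n [t [r' bE]]]; exists n.+1, (c * t), (j c * r').
transitivity (j c * (j y ^+ n * (j b * a))).
  by rewrite exprS {1}yE rmorphM; ring.
by rewrite bE rmorphM; ring.
Qed.

End Clearing.

(** * Primality of [Delta] and factoriality *)

Section DeltaPrime.

Variable K : fieldType.
Local Notation S := {mpoly K[19]}.
Local Notation R := (R_Pi K).
Local Notation B := {mpoly K[15]}.
Local Notation X k := ('X_(inord k) : B).
Local Notation coord := (Pi_coord K).
Local Notation scal := (@scal K).
Local Notation Pi_proj := (@Pi_proj K).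
Local Notation chartR := (@chartR K).
Local Notation par := (par_eval scal coord).

Local Notation T := {mpoly K[14]}.
Local Notation Z k := ('X_(inord k) : T).

Definition chart0R : T -> R := @subst K 13 R scal (fun k => (Delta0_coords coord)`_k).

HB.instance Definition _ := GRing.RMorphism.on chart0R.

Lemma chart0RX k : (k < 14)%N -> chart0R (Z k) = (Delta0_coords coord)`_k.
Proof. by move=> lt_k; rewrite /chart0R substX. Qed.

Definition cubicT : T :=
  Z 7 * Z 1 ^+ 3 + 3 * Z 8 * Z 1 ^+ 2 * Z 2 + 3 * Z 9 * Z 1 * Z 2 ^+ 2
  + Z 10 * Z 2 ^+ 3.

Lemma chart0R_cubicT : chart0R cubicT = cubic_form coord.
Proof.
rewrite /cubicT !(rmorphD chart0R, rmorphM chart0R, rmorphXn chart0R, rmorph_nat chart0R) /=.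
by rewrite !chart0RX.
Qed.

Definition unitT : T := Z 1 * cubicT.

Lemma chart0R_unitT : chart0R unitT = Delta0_unit K.
Proof. by rewrite (rmorphM chart0R) /= chart0R_cubicT chart0RX. Qed.

Lemma Delta0_clear r : cleared chart0R (chartR (Delta15 K)) unitT r.
Proof.
have [a <-] := Pi_proj_surj r.
elim/mpoly_gen_ind: a => [c|i|p q pP qP|p q pP qP].
- have -> : Pi_proj c%:MP = chart0R c%:MP by rewrite /chart0R substC.
  exact: cleared_image.
- rewrite -(inord_val i) -[Pi_proj _]/(coord i).
  apply: (Delta0_ind (@Pi_coord_point K)) (ltn_ord i) => [n|a b|a|a b|a|a|a|k lt_k].
  + by rewrite -(rmorph_nat chart0R); apply: cleared_image.
  + exact: clearedD.
  + exact: clearedN.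
  + exact: clearedM.
  + by rewrite -chartR_Delta; apply: cleared_multiple.
  + by rewrite -[coord 1](@chart0RX 1) //; apply: cleared_cancel.
  + by rewrite -chart0R_cubicT; apply: cleared_cancel; rewrite /unitT mulrC.
  + by rewrite -chart0RX //; apply: cleared_image.
- by rewrite (rmorphD Pi_proj); apply: clearedD.
- by rewrite (rmorphM Pi_proj); apply: clearedM.
Qed.

(** The point p2 = L135 = 1 shows that the cubic form is nonzero in every characteristic. *)
Lemma cubicT_eval : @subst K 13 K idfun (fun k => ((k == 1%N) || (k == 7%N))%:R) cubicT = 1.
Proof.
pose h : {rmorphism T -> K} := @subst K 13 K idfun (fun k => ((k == 1%N) || (k == 7%N))%:R).
rewrite -[LHS]/(h cubicT) /cubicT !(rmorphD h, rmorphM h, rmorphXn h, rmorph_nat h) /= /h !substX //=.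
by ring.
Qed.

(** Evaluation at the generic point of the divisor, which [Delta0_point] supplies over the field of
    fractions of [T]. *)
Lemma Delta0_hom : exists psi : {rmorphism S -> {fraction T}},
  [/\ forall a, Pi_proj a = 0 -> psi a = 0,
      forall a, Pi_proj a = chartR (Delta15 K) -> psi a = 0 &
      forall a t, Pi_proj a = chart0R t -> psi a = tofrac t].
Proof.
pose io : {rmorphism T -> {fraction T}} := @tofrac _.
have io_eq0 t : t != 0 -> io t != 0 by rewrite tofrac_eq0.
have p20 : io (Z 1) != 0 by rewrite io_eq0 // -msize_poly_eq0 msizeX mdeg1.
have f0 : io cubicT != 0.
  rewrite io_eq0 //; apply: contra_eq_neq cubicT_eval => ->.
  by rewrite rmorph0 eq_sym oner_eq0.
have [||x [xP xD xE _]] := @Delta0_point _ (fun k => io (Z k)).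
- exact: p20.
- move: f0; rewrite /cubicT.
  by rewrite !(rmorphD io, rmorphM io, rmorphXn io, rmorph_nat io).
pose psi : {rmorphism S -> {fraction T}} := @subst K 18 _ (io \o @mpolyC 14 K) x.
have psi0 a : Pi_proj a = 0 -> psi a = 0 by apply: ev_Pi_proj xP.
have psi_eq a b : Pi_proj a = Pi_proj b -> psi a = psi b.
  move=> ab; apply/subr0_eq; rewrite -(rmorphB psi); apply: psi0.
  by rewrite (rmorphB Pi_proj) /= ab subrr.
have psiX k : (k < 19)%N -> psi (Pi_var K k) = x k.
  by move=> lt_k; rewrite /psi /= substX.
exists psi; split=> // [a aE|a t aE].
  rewrite -[RHS]xD -!psiX // -!(rmorphM psi) -(rmorphB psi); apply: psi_eq.
  by rewrite aE chartR_Delta (rmorphB Pi_proj) !(rmorphM Pi_proj).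
pose jS := @subst K 13 S (@mpolyC 19 K) (fun k => (Delta0_coords (Pi_var K))`_k).
have coordsE (E F : comNzRingType) (g : {rmorphism E -> F}) y :
    map g (Delta0_coords y) = Delta0_coords (g \o y).
  by rewrite /Delta0_coords /= !(rmorphB g) !(rmorphD g) !(rmorphM g).
have jSE t' : Pi_proj (jS t') = chart0R t'.
  move: t'; apply: (hom_ext_inord (f := Pi_proj \o jS) (g := chart0R)) => [c|k lt_k] /=.
    by rewrite /jS /chart0R !substC.
  by rewrite /jS /chart0R !substX // (nth_rmorph Pi_proj) coordsE.
have psij t' : psi (jS t') = io t'.
  move: t'; apply: (hom_ext_inord (f := psi \o jS) (g := io)) => [c|k lt_k] /=.
    by rewrite /jS /psi /= !substC.
  rewrite /jS substX // -xE // (nth_rmorph psi) coordsE; congr nth.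
  by rewrite /Delta0_coords /= !psiX.
by rewrite -[RHS]psij; apply: psi_eq; rewrite jSE.
Qed.

(** The map [psi] embeds the quotient by [Delta] in a field: if [psi] kills an element, clearing
    denominators leaves a [t] with image 0, so [Delta] divides the element times a power of
    [Delta0_unit], and that power is removed by [Delta0_unit_nzd]. *)
Lemma chartR_Delta_prime : prime_elt (chartR (Delta15 K)).
Proof.
have [psi [psi0 psiD psij]] := Delta0_hom; set D := chartR (Delta15 K).
have [d dE] := Pi_proj_surj D.
have psi_multiple a b : Pi_proj a = b * D -> psi a = 0.
  have [b' <-] := Pi_proj_surj b; move=> aE.
  have : psi (a - b' * d) = 0.
    by apply: psi0; rewrite (rmorphB Pi_proj) (rmorphM Pi_proj) /= dE aE subrr.
  by rewrite (rmorphB psi) (rmorphM psi) /= (psiD d dE) mulr0 subr0.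
have ker_psi a : psi a = 0 -> divides D (Pi_proj a).
  move=> a0; have [n [t [r' aE]]] := Delta0_clear (Pi_proj a).
  have t0 : t = 0.
    have [e eE] := Pi_proj_surj r'; have [y yE] := Pi_proj_surj (chart0R unitT).
    apply/eqP; rewrite -tofrac_eq0 -(psij (y ^+ n * a - d * e)).
      rewrite (rmorphB psi) !(rmorphM psi) /= a0 mulr0 (psiD d dE) mul0r subrr.
      exact: eqxx.
    rewrite (rmorphB Pi_proj) !(rmorphM Pi_proj) (rmorphXn Pi_proj) /=.
    by rewrite yE dE eE aE -/D addrK.
  have nzd k : divides D (Delta0_unit K ^+ k * Pi_proj a) -> divides D (Pi_proj a).
    elim: k => [|k IH]; first by rewrite mul1r.
    by rewrite exprS -mulrA => /Delta0_unit_nzd.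
  apply: (nzd n); exists r'.
  by rewrite -chart0R_unitT aE t0 (rmorph0 chart0R) add0r mulrC.
split=> [D0|[b bD]|r s [q rsE]].
- apply: (@Delta15_neq0 K); apply: chartR_inj; rewrite -/D D0.
  by rewrite (rmorph0 chartR).
- have : psi 1 = 0 by apply: (psi_multiple 1 b); rewrite (rmorph1 Pi_proj).
  by rewrite rmorph1 => /eqP; rewrite oner_eq0.
have [a aE] := Pi_proj_surj r; have [b bE] := Pi_proj_surj s.
have : psi (a * b) = 0.
  by apply: (psi_multiple _ q); rewrite (rmorphM Pi_proj) /= aE bE.
rewrite (rmorphM psi) => /idomain_is_domain[/ker_psi|/ker_psi].
  by rewrite aE; left.
by rewrite bE; right.
Qed.

Theorem R_Pi_UFD : is_UFD (R_Pi K).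
Proof.
apply: factorial_UFD; first exact: R_domain.
apply: (nagata (iota := chartR) (delta := Delta15 K)).
- exact: R_domain.
- exact: chartR_inj.
- exact: chartR_Delta_prime.
- exact: R_separated.
- exact: R_clear.
- exact: mpoly_factorial.
Qed.

End DeltaPrime.

Theorem proposition6p3 (R : realType) : is_UFD (R_Pi R[i]).
Proof. exact: R_Pi_UFD. Qed.
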